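(* Let $K=\bigcup_{j=1}^m[a_j,b_j]$ be a finite disjoint union of closed intervals with $a_j,b_j\in\mathbb Z$ and $a_j<b_j$ for $1\le j\le m$. Let $y_1,\dots,y_n\in\mathbb R\setminus K$, let $\mathbf t=(t_0,\dots,t_n)$ with $0\le t_i\le1$ and $\sum_{i=0}^nt_i=1$, and let $$\mu_{\mathbf t}:=\mu_{\mathbf t}(\{y_i\},K)=t_0\,\nu_K+\sum_{i=1}^nt_i\,\omega(y_i,K).$$ Then $\int\log|Q(z)|\,d\mu_{\mathbf t}(z)\ge0$ for all $Q\in\mathbb Z[z]\setminus\{0\}$ if and only if for every $1\le j\le m$ $$\int\log|z-a_j|\,d\mu_{\mathbf t}(z)\ge0\quad\text{and}\quad\int\log|z-b_j|\,d\mu_{\mathbf t}(z)\ge0.$$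
   Context: Potential theory. $\mathcal P(K)$ is the set of Borel probability measures with support contained in the compact set $K$. For a finite compactly supported Borel measure $\mu$, $I(\mu)=\iint\log\frac1{|z-w|}\,d\mu(z)\,d\mu(w)$. The logarithmic capacity of a compact set $K$ is $c(K)=\exp(-\inf_{\mu\in\mathcal P(K)}I(\mu))$; for a general set $E$, $c(E)$ is the supremum of $c(K')$ over compact $K'\subset E$. If $c(K)>0$, the equilibrium measure $\nu_K$ is the unique minimizer of $I$ over $\mathcal P(K)$. ''Quasi-everywhere'' means except on a set of logarithmic capacity zero. For a domain $\Omega\subset\widehat{\mathbb C}$ with $c(\partial\Omega)>0$ and $y\in\Omega$, the harmonic measure $\omega(y,\Omega)$ is the unique Borel probability measure on $\partial\Omega$ with $u(y)=\int f\,d\omega(y,\Omega)$ for every continuous $f$ on $\partial\Omega$, where $u$ is the (bounded) harmonic function on $\Omega$ whose boundary values agree with $f$ quasi-everywhere on $\partial\Omega$. For $y\notin K$, $\omega(y,K):=\omega(y,\Omega)$, where $\Omega$ is the connected component of $\widehat{\mathbb C}\setminus K$ containing $y$; it is regarded as a measure on $K$. *)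

(* Defs.v *)
From HB Require Import structures.
From mathcomp Require Import all_boot all_order all_algebra.
From mathcomp Require Import all_classical all_reals all_analysis.
From mathcomp Require Import complex.
Import Order.TTheory GRing.Theory Num.Theory.
Import numFieldNormedType.Exports.

Set Implicit Arguments.
Unset Strict Implicit.
Unset Printing Implicit Defensive.

Local Open Scope classical_set_scope.
Local Open Scope ring_scope.

(* The complex plane is the real plane R * R, with its product topology and    *)
(* product (= Borel) sigma-algebra; R[i] is used only for complex arithmetic.  *)
(* The Riemann sphere is its one-point compactification (None = infinity).     *)
Notation plane R := (R * R)%type.
Notation sphere R := (one_point_compactification (R * R)%type).

Section complex_plane.
Context {R : realType}.
Implicit Types (z : plane R) (Q : {poly int}).

Definition toC z : R[i] := (z.1 +i* z.2)%C.

Definition ofC (w : R[i]) : plane R := (complex.Re w, complex.Im w).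

Definition ofR (x : R) : plane R := (x, 0).

(* Extended real valued, because ln 0 = 0 in the library while lne 0 = -oo.    *)
Definition log_abs (w : R[i]) : \bar R := lne (Normc.normc w)%:E.

Definition peval Q z : R[i] := (map_poly intr Q).[toC z].

End complex_plane.

Section potential_theory.
Context {R : realType}.
Implicit Types (K E U : set (plane R)) (W : set (sphere R)).

(* For K closed, "support contained in K" amounts to "no mass outside K".      *)
Definition prob_on K : set (probability (plane R) R) :=
  [set mu | mu (~` K) = 0%E].

(* Meaningful for finite mu with compact support: the integrand is then        *)
(* bounded from below off a null set.                                          *)
Definition energy (mu : {measure set (plane R) -> \bar R}) : \bar R :=
  (\int[mu]_z \int[mu]_w (- log_abs (toC (z - w)%R)))%E.

Definition compact_capacity K : \bar R :=
  expeR (- ereal_inf [set energy mu | mu in prob_on K])%E.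

Definition capacity E : \bar R :=
  ereal_sup [set compact_capacity K | K in [set K | compact K /\ K `<=` E]].

(* To be used for K compact of positive capacity. *)
Definition equilibrium_measure K (nu : probability (plane R) R) : Prop :=
  prob_on K nu /\
  forall mu : probability (plane R) R, prob_on K mu -> (energy nu <= energy mu)%E.

Definition partial_x (u : plane R -> R) : plane R -> R := 'D_(1, 0) u.
Definition partial_y (u : plane R -> R) : plane R -> R := 'D_(0, 1) u.

Definition C1_on U (u : plane R -> R) : Prop :=
  forall z, U z ->
    [/\ derivable u z (1, 0), derivable u z (0, 1),
        {for z, continuous (partial_x u)} & {for z, continuous (partial_y u)}].

Definition harmonic_on U (u : plane R -> R) : Prop :=
  [/\ C1_on U u, C1_on U (partial_x u), C1_on U (partial_y u) &
      forall z, U z ->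
        partial_x (partial_x u) z + partial_y (partial_y u) z = 0].

(* The coordinate w |-> 1/w around the point at infinity. *)
Definition chart_infty (z : plane R) : sphere R :=
  if z == 0 then None else Some (ofC (toC z)^-1).

Definition sphere_harmonic W (u : sphere R -> R) : Prop :=
  harmonic_on (Some @^-1` W) (u \o Some) /\
  harmonic_on (chart_infty @^-1` W) (u \o chart_infty).

(* The finite part of the boundary in the sphere. It is the whole boundary for *)
(* the components of the complement of a compact subset of the plane.          *)
Definition boundary W : set (plane R) :=
  Some @^-1` (closure W `\` interior W).

Definition dirichlet_solution W (f : plane R -> R) (u : sphere R -> R) : Prop :=
  [/\ sphere_harmonic W u,
      exists M : R, forall w, W w -> `|u w| <= M &
      capacity [set z | boundary W z /\
        ~ (u (Some x) @[x --> within (Some @^-1` W) (nbhs z)] --> f z)]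
      = 0%E].

(* To be used for W a domain with boundary of positive capacity, in which case *)
(* u exists and is unique on W.                                                *)
Definition domain_harmonic_measure (y : sphere R) W
    (omega : probability (plane R) R) : Prop :=
  prob_on (boundary W) omega /\
  forall f : plane R -> R, {within boundary W, continuous f} ->
    (exists u, dirichlet_solution W f u) /\
    (forall u, dirichlet_solution W f u ->
      (u y)%:E = (\int[omega]_(z in boundary W) (f z)%:E)%E).

Definition harmonic_measure (y : plane R) K
    (omega : probability (plane R) R) : Prop :=
  domain_harmonic_measure (Some y)
    (connected_component (~` (Some @` K) : set (sphere R)) (Some y)) omega.

End potential_theory.

Section mixture.
Context {R : realType} {n : nat}.
Variables (t : 'I_n.+1 -> {nonneg R}).
Variables (nu : probability (plane R) R) (omega : 'I_n -> probability (plane R) R).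
Local Open Scope ereal_scope.

Definition mixture (A : set (plane R)) : \bar R :=
  (t ord0)%:num%:E * nu A +
  \sum_(i < n) (t (lift ord0 i))%:num%:E * omega i A.

Let mixture0 : mixture set0 = 0.
Proof. by rewrite /mixture measure0 mule0 add0e big1// => i _; rewrite measure0 mule0. Qed.

Let mixture_ge0 A : 0 <= mixture A.
Proof. by rewrite adde_ge0 ?mule_ge0// sume_ge0// => i _; rewrite mule_ge0. Qed.

Let mixture_sigma_additive : semi_sigma_additive mixture.
Proof.
move=> F mF tF mUF.
pose w (k : nat) : {measure set (plane R) -> \bar R} :=
  if insub k is Some i then mscale (t (lift ord0 i)) (omega i) else mzero.
have -> : mixture = measure_add (mscale (t ord0) nu) (msum w n).
  apply/funext => A; rewrite measure_addE /mixture /mscale /msum; congr (_ + _).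
  by apply: eq_bigr => i _; rewrite /w valK.
exact: measure_semi_sigma_additive.
Qed.

HB.instance Definition _ := isMeasure.Build _ _ _ mixture
  mixture0 mixture_ge0 mixture_sigma_additive.

End mixture.

Definition integer_intervals {R : realType} {m : nat} (a b : 'I_m -> int) :
    set R :=
  \bigcup_j `[(a j)%:~R, (b j)%:~R]%classic.

(* Main.v *)
Require Import Defs.
From HB Require Import structures.
From mathcomp Require Import all_boot all_order all_algebra.
From mathcomp Require Import all_classical all_reals all_analysis measurable_realfun.
From mathcomp Require Import complex ring lra.
Import Order.TTheory GRing.Theory Num.Theory.
Import numFieldNormedType.Exports.

(** Write U(x) for the integral of log |z - x| against mu = mixture t nu omega,
    and K for the union of the intervals.

    Necessity is the case Q = X - a_j or Q = X - b_j.

    For sufficiency, factoring Q over the complex numbers gives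
    int log |Q| dmu = log |lead Q| + sum of U(w) over the roots w, and the
    leading coefficient is a nonzero integer; so it is enough that U >= 0 on the
    whole plane.  This follows from two facts.

    - U is concave on each interval of K, so that U >= 0 at the end points gives
      U >= 0 on K.  Indeed the potential of the equilibrium measure is constant
      on K ([equilibrium_potential]), and the potential of the harmonic measure
      at y_i is log |x - y_i| up to a constant ([harmonic_measure_potential]),
      which is concave on an interval that avoids y_i.

    - U >= 0 on K implies U >= 0 everywhere ([log_potential_ge0]).  As mu lives
      on the real line, |z - w| >= |z - Re w| reduces this to real w; on a gap of
      K every function x |-> log |z - x| with z in K is concave, and beyond the
      extreme points of K it is monotone ([pot_max_principle]).  This elementary
      argument takes the place of the maximum principle.

    Both formulas for potentials on K are obtained by testing against uniform
    measures on segments inside K, whose potential [segpot] is continuous in the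
    plane and harmonic off the segment, and by letting the segment shrink to a
    point ([mutual_energy_segment_cvg]).

    - For the equilibrium measure, moving a little mass to a segment does not
      decrease the energy, which in the limit shows that the integral of
      - log |z - x| against nu is at least I(nu) for x in K.  Its own integral
      against nu is I(nu), so equality holds almost everywhere, on a closed set
      by lower semicontinuity, hence on all of K by the same convexity argument
      in the gaps of that set.

    - For the harmonic measure, the difference of two segment potentials is
      harmonic on the complement of K in the sphere, including the point at
      infinity, and continuous up to K.  It therefore solves the Dirichlet
      problem with its own boundary values, so its integral against the harmonic
      measure at y is its value at y ([integral_harmonic_measure_segpot]).

    To stay with nonnegative functions, where Tonelli's theorem and Fatou's lemma
    apply, potentials are computed with the truncated kernel max(0, D - log |z - w|)
    ([logker]), D being a bound for the logarithms of the distances in play. *)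

Set Implicit Arguments.
Unset Strict Implicit.
Unset Printing Implicit Defensive.

Local Open Scope classical_set_scope.
Local Open Scope ring_scope.

(** * Integrals over the unit interval that depend on a parameter *)

Section parametric_integrals.
Context {R : realType}.
Local Notation mu := (@lebesgue_measure R).
Local Notation I01 := (`[0%R, 1%R]%classic : set R).

(** Compactness of the unit interval makes joint continuity uniform in the
    parameter s; this is what passes continuity and derivatives through the
    integral. *)
Lemma near_unit_itv_uniform {T : topologicalType} (k : R -> T -> R) (z : T) :
  (forall s, I01 s -> {for (s, z), continuous (fun p => k p.1 p.2)}) ->
  forall e, 0 < e -> \forall z' \near z, forall s, I01 s -> `|k s z' - k s z| <= e.
Proof.
move=> kc e e0.
have := @segment_compact R 0 1; move/compact_near_coveringP.
move=> /(_ T (nbhs z) (fun z' s => `|k s z' - k s z| <= e)); apply.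
move=> s Is.
have e20 : 0 < e / 2 by rewrite divr_gt0.
have /cvgrPdist_le/(_ _ e20) := kc _ Is.
case=> -[A B] /= [As Bz] AB.
exists (A, B) => //= -[s' z'] /= [As' Bz'].
have h1 := AB (s', z') (conj As' Bz').
have h2 := AB (s', z) (conj As' (nbhs_singleton Bz)).
rewrite /= in h1 h2.
rewrite (_ : k s' z' - k s' z = (k s z - k s' z) - (k s z - k s' z')); last by ring.
by rewrite (le_trans (ler_normB _ _))// (splitr e) lerD.
Qed.

Lemma integrable_unit_itv (f : R -> R) : {within I01, continuous f} ->
  mu.-integrable I01 (EFin \o f).
Proof.
move=> cf; apply: continuous_compact_integrable => //; exact: segment_compact.
Qed.

Lemma continuous_at_slice {T : topologicalType} (k : R -> T -> R) (s : R) (z : T) :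
  {for (s, z), continuous (fun p => k p.1 p.2)} ->
  {for s, continuous (k ^~ z)}.
Proof.
move=> kc.
have kc' : k (s', z).1 (s', z).2 @[s' --> s] --> k s z.
  apply: (@continuous_comp _ _ _ (fun s' : R => (s', z)) (fun p : R * T => k p.1 p.2) s _ kc).
  by apply: (@cvg_pair _ _ _ (nbhs s) (nbhs s) (nbhs z)); [exact: cvg_id|exact: cvg_cst].
exact: kc'.
Qed.

Lemma integrable_slice {T : topologicalType} (k : R -> T -> R) (z : T) :
  (forall s, I01 s -> {for (s, z), continuous (fun p => k p.1 p.2)}) ->
  mu.-integrable I01 (EFin \o k ^~ z).
Proof.
move=> kc; apply: integrable_unit_itv.
apply: continuous_in_subspaceT => s /set_mem Is.
exact: continuous_at_slice (kc _ Is).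
Qed.

Lemma le_norm_Rintegral_unit (f : R -> R) e :
  mu.-integrable I01 (EFin \o f) -> (forall s, I01 s -> `|f s| <= e) ->
  `| \int[mu]_(s in I01) f s | <= e.
Proof.
move=> fi fe.
apply: (le_trans (le_normr_Rintegral _ fi)) => //.
have -> : e = \int[mu]_(s in I01) (cst e s).
  rewrite Rintegral_cst//=.
  by rewrite [X in fine X]lebesgue_measure_itv/= lte01 oppr0 adde0 mulr1.
apply: le_Rintegral => //.
- exact: integrable_norm.
- by apply: integrable_unit_itv; apply: continuous_subspaceT => x; exact: cvg_cst.
Qed.

Lemma continuous_Rintegral_unit {T : topologicalType} (k : R -> T -> R) (z : T) :
  (\forall z' \near z, forall s, I01 s ->
    {for (s, z'), continuous (fun p => k p.1 p.2)}) ->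
  {for z, continuous (fun z' => \int[mu]_(s in I01) k s z')}.
Proof.
move=> kc.
have kcz := nbhs_singleton kc.
apply/cvgrPdist_le => e e0.
have := near_unit_itv_uniform kcz e0.
apply: filterS2 kc => z' kcz' h.
rewrite distrC -RintegralB//; [|exact: integrable_slice|exact: integrable_slice].
apply: le_norm_Rintegral_unit => //.
have := @integrableB _ _ _ mu _ (measurable_itv _) _ _ (integrable_slice kcz') (integrable_slice kcz).
by apply: eq_integrable => // s _ /=; rewrite EFinB.
Qed.

(** Reduces a directional derivative to a derivative of a function of one real
    variable, for which the chain rule and differentiation under the integral
    sign are available. *)
Lemma is_derive_along_line {V : normedModType R} (g : V -> R) (z v : V) (x d : R) :
  is_derive (z + x *: v) v g d <-> is_derive x 1 (fun x' => g (z + x' *: v)) d.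
Proof.
have E : (fun h : R => h^-1 *: ((g \o shift (z + x *: v)) (h *: v) - g (z + x *: v)))
  = (fun h : R => h^-1 *: (((fun x' => g (z + x' *: v)) \o shift x) (h *: 1) -
      g (z + x *: v))).
  apply/funext => h /=; congr (_ *: (g _ - _)).
  by rewrite scaler1 scalerDl addrCA.
by split=> -[]; rewrite /derivable /derive ?E -?E => dg <-; apply: DeriveDef;
  rewrite /derivable /derive ?E -?E.
Qed.

(** The dominating constant is C + 1 + 1, where C + 1 bounds k' s z over s and the
    other 1 is the variation of k' near z, uniform in s. *)
Lemma is_derive_Rintegral_unit {V : normedModType R} (k k' : R -> V -> R) (z v : V) :
  (\forall z' \near z, forall s, I01 s ->
    {for (s, z'), continuous (fun p => k p.1 p.2)}) ->
  (\forall z' \near z, forall s, I01 s ->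
    {for (s, z'), continuous (fun p => k' p.1 p.2)}) ->
  (\forall z' \near z, forall s, I01 s -> is_derive z' v (k s) (k' s z')) ->
  is_derive z v (fun z' => \int[mu]_(s in I01) k s z')
    (\int[mu]_(s in I01) k' s z).
Proof.
move=> kc k'c dk.
pose f (x s : R) := k s (z + x *: v).
have line0 : (fun x : R => z + x *: v) x @[x --> (0 : R)] --> z.
  rewrite -[X in _ --> X]addr0 -[X in _ --> _ + X](scale0r v).
  by apply: cvgD; [exact: cvg_cst|exact: scalel_continuous].
have k'cz := nbhs_singleton k'c.
have [C [_ HC]] : \forall C \near +oo, forall s, I01 s -> `|k' s z| <= C.
  have : bounded_set ((k' ^~ z) @` I01).
    apply: compact_bounded; apply: continuous_compact; last exact: segment_compact.
    apply: continuous_in_subspaceT => s /set_mem Is.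
    exact: continuous_at_slice (k'cz _ Is).
  by case=> C [Cr HC]; exists C; split=> // C1 CC1 s Is; apply: (HC _ CC1); exists s.
have {}HC s : I01 s -> `|k' s z| <= C + 1 by apply: HC; rewrite ltrDl.
have near1 := near_unit_itv_uniform k'cz ltr01.
have near_z : \forall z' \near z, [/\ forall s, I01 s ->
     {for (s, z'), continuous (fun p => k p.1 p.2)},
   forall s, I01 s -> is_derive z' v (k s) (k' s z') &
   forall s, I01 s -> `|k' s z' - k' s z| <= 1].
  by near=> z'; split; near: z'.
have /nbhs_ballP[rho /= rho0 Hrho] := line0 _ near_z.
have {}Hrho x : `]- rho, rho[%classic x -> [/\ forall s, I01 s ->
     {for (s, z + x *: v), continuous (fun p => k p.1 p.2)},
   forall s, I01 s -> is_derive (z + x *: v) v (k s) (k' s (z + x *: v)) &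
   forall s, I01 s -> `|k' s (z + x *: v) - k' s z| <= 1].
  rewrite /= in_itv/= => xrho; apply: Hrho.
  by rewrite -ball_normE /= sub0r normrN ltr_norml.
have I0 : `]- rho, rho[%classic (0 : R) by rewrite /= in_itv/= oppr_lt0 rho0.
have df x s : `]- rho, rho[%classic x -> I01 s ->
    is_derive x 1 (f ^~ s) (k' s (z + x *: v)).
  move=> /Hrho[_ dk' _] Is.
  by have /is_derive_along_line := dk' s Is.
have := @cvg_differentiation_under_integral R _ _ mu f _ (measurable_itv `[0%R, 1%R])
  0 (- rho) rho I0 _ _ (fun=> C + 1 + 1).
have intf x : `]- rho, rho[%classic x -> mu.-integrable I01 (EFin \o f x).
  by move=> /Hrho[kcx _ _]; exact: integrable_slice kcx.
have d1 x s : `]- rho, rho[%classic x -> I01 s ->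
    partial1of2 f x s = k' s (z + x *: v).
  move=> Ix Is; rewrite partial1of2E.
  by have := df _ _ Ix Is => -[].
move=> /(_ intf) H.
have {}H : h^-1 *: (\int[mu]_(s in I01) f (h + 0) s - \int[mu]_(s in I01) f 0 s)
   @[h --> 0^'] --> \int[mu]_(s in I01) k' s z.
  have -> : \int[mu]_(s in I01) k' s z = \int[mu]_(s in I01) (partial1of2 f) 0 s.
    apply: eq_Rintegral => s /set_mem Is.
    by rewrite d1// scale0r addr0.
  apply: H.
  - by move=> x s Ix Is; have := df _ _ Ix Is => -[].
  - have I00 : I01 0 by rewrite /= in_itv/= lexx ler01.
    by move=> _; rewrite addr_ge0// (le_trans _ (HC _ I00)).
  - apply: integrable_unit_itv.
    by apply: continuous_subspaceT => x; exact: cvg_cst.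
  - move=> x s Ix Is; rewrite d1//.
    have [_ _ /(_ _ Is) h] := Hrho _ Ix.
    rewrite -[k' s _](subrK (k' s z)) (le_trans (ler_normD _ _))//.
    by rewrite addrC lerD// HC.
have E : (fun h : R => h^-1 *: (((fun z' => \int[mu]_(s in I01) k s z') \o shift z) (h *: v) -
     \int[mu]_(s in I01) k s z)) =
  (fun h => h^-1 *: (\int[mu]_(s in I01) f (h + 0) s - \int[mu]_(s in I01) f 0 s)).
  apply/funext => h /=; congr (_ *: (_ - _)); apply: eq_Rintegral => s _.
    by rewrite /f addr0 addrC.
  by rewrite /f scale0r addr0.
apply: DeriveDef; rewrite /derivable /derive E; last exact/cvg_lim.
by apply/cvg_ex; eexists; exact: H.
Unshelve. all: by end_near. Qed.

End parametric_integrals.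

(** * Algebra of harmonic functions *)

Section harmonic_algebra.
Context {R : realType}.
Implicit Types (U : set (plane R)) (u v : plane R -> R) (z w : plane R).

(** Derivatives only see germs, so on an open set nothing depends on the values
    outside. *)
Lemma C1_on_eq U u v : open U -> (forall z, U z -> u z = v z) ->
  C1_on U u -> C1_on U v.
Proof.
move=> oU uv C1u z Uz; have [dx dy cx cy] := C1u z Uz.
have near_uv z' : U z' -> {near z', u =1 v}.
  by move=> Uz'; apply: filterS (open_nbhs_nbhs (conj oU Uz')); exact: uv.
have near_z : \forall z' \near z, U z' by exact: open_nbhs_nbhs.
have Ex z' : U z' -> partial_x u z' = partial_x v z'.
  by move=> Uz'; rewrite /partial_x (near_eq_derive _ (near_uv _ Uz')).
have Ey z' : U z' -> partial_y u z' = partial_y v z'.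
  by move=> Uz'; rewrite /partial_y (near_eq_derive _ (near_uv _ Uz')).
split.
- exact: near_eq_derivable (near_uv _ Uz) dx.
- exact: near_eq_derivable (near_uv _ Uz) dy.
- change (partial_x v z' @[z' --> z] --> partial_x v z).
  rewrite -(Ex z Uz).
  apply: (@cvg_trans _ (partial_x u z' @[z' --> z])) _ cx; apply: near_eq_cvg.
  by apply: filterS near_z => z' /Ex.
- change (partial_y v z' @[z' --> z] --> partial_y v z).
  rewrite -(Ey z Uz).
  apply: (@cvg_trans _ (partial_y u z' @[z' --> z])) _ cy; apply: near_eq_cvg.
  by apply: filterS near_z => z' /Ey.
Qed.

Lemma C1_onB U u v : open U -> C1_on U u -> C1_on U v -> C1_on U (u \- v).
Proof.
move=> oU C1u C1v z Uz.
have [ux uy cux cuy] := C1u z Uz; have [vx vy cvx cvy] := C1v z Uz.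
have near_z : \forall z' \near z, U z' by exact: open_nbhs_nbhs.
split; [exact: derivableB|exact: derivableB| |].
- change (partial_x (u \- v) z' @[z' --> z] --> partial_x (u \- v) z).
  rewrite [X in _ --> X]/partial_x deriveB//.
  apply: cvg_trans (cvgB cux cvx); apply: near_eq_cvg.
  apply: filterS near_z => z' Uz'.
  have [u'x _ _ _] := C1u z' Uz'; have [v'x _ _ _] := C1v z' Uz'.
  by rewrite /partial_x deriveB.
- change (partial_y (u \- v) z' @[z' --> z] --> partial_y (u \- v) z).
  rewrite [X in _ --> X]/partial_y deriveB//.
  apply: cvg_trans (cvgB cuy cvy); apply: near_eq_cvg.
  apply: filterS near_z => z' Uz'.
  have [_ u'x _ _] := C1u z' Uz'; have [_ v'x _ _] := C1v z' Uz'.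
  by rewrite /partial_y deriveB.
Qed.

Lemma harmonic_onB U u v : open U ->
  harmonic_on U u -> harmonic_on U v -> harmonic_on U (u \- v).
Proof.
move=> oU [C1u C1ux C1uy Du] [C1v C1vx C1vy Dv].
have Ex z : U z -> (partial_x u \- partial_x v) z = partial_x (u \- v) z.
  move=> Uz; have [ux _ _ _] := C1u z Uz; have [vx _ _ _] := C1v z Uz.
  by rewrite /partial_x deriveB.
have Ey z : U z -> (partial_y u \- partial_y v) z = partial_y (u \- v) z.
  move=> Uz; have [_ ux _ _] := C1u z Uz; have [_ vx _ _] := C1v z Uz.
  by rewrite /partial_y deriveB.
split; first exact: C1_onB.
- exact: C1_on_eq Ex (C1_onB _ _ _).
- exact: C1_on_eq Ey (C1_onB _ _ _).
- move=> z Uz.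
  have near_z : \forall z' \near z, U z' by exact: open_nbhs_nbhs.
  have [uxx _ _ _] := C1ux z Uz; have [vxx _ _ _] := C1vx z Uz.
  have [_ uyy _ _] := C1uy z Uz; have [_ vyy _ _] := C1vy z Uz.
  have -> : partial_x (partial_x (u \- v)) z = partial_x (partial_x u) z - partial_x (partial_x v) z.
    have near_E : {near z, partial_x (u \- v) =1 partial_x u \- partial_x v}.
      by apply: filterS near_z => z' /Ex.
    rewrite [LHS](near_eq_derive _ near_E).
    exact: deriveB uxx vxx.
  have -> : partial_y (partial_y (u \- v)) z = partial_y (partial_y u) z - partial_y (partial_y v) z.
    have near_E : {near z, partial_y (u \- v) =1 partial_y u \- partial_y v}.
      by apply: filterS near_z => z' /Ey.
    rewrite [LHS](near_eq_derive _ near_E).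
    exact: deriveB uyy vyy.
  move: (Du z Uz) (Dv z Uz).
  move: (partial_x (partial_x u) z) (partial_y (partial_y u) z).
  move: (partial_x (partial_x v) z) (partial_y (partial_y v) z) => p q r s.
  by rewrite addrACA -opprD => -> ->; rewrite subrr.
Qed.

Lemma harmonic_on_eq U u v : open U -> (forall z, U z -> u z = v z) ->
  harmonic_on U u -> harmonic_on U v.
Proof.
move=> oU uv [C1u C1ux C1uy Du].
have near_eq (f g : plane R -> R) z : (forall z, U z -> f z = g z) -> U z -> {near z, f =1 g}.
  by move=> fg Uz; apply: filterS (open_nbhs_nbhs (conj oU Uz)); exact: fg.
have Ex z : U z -> partial_x u z = partial_x v z.
  by move=> Uz; rewrite /partial_x (near_eq_derive _ (near_eq _ _ _ uv Uz)).
have Ey z : U z -> partial_y u z = partial_y v z.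
  by move=> Uz; rewrite /partial_y (near_eq_derive _ (near_eq _ _ _ uv Uz)).
split; first exact: (C1_on_eq oU uv C1u).
- exact: (@C1_on_eq U (partial_x u) (partial_x v) oU Ex C1ux).
- exact: (@C1_on_eq U (partial_y u) (partial_y v) oU Ey C1uy).
- move=> z Uz; move: (Du z Uz).
  have nx : {near z, partial_x u =1 partial_x v} by exact: near_eq.
  have ny : {near z, partial_y u =1 partial_y v} by exact: near_eq.
  have Exx : partial_x (partial_x u) z = partial_x (partial_x v) z.
    exact: (@near_eq_derive R _ _ (partial_x u) (partial_x v) z (1, 0) nx).
  have Eyy : partial_y (partial_y u) z = partial_y (partial_y v) z.
    exact: (@near_eq_derive R _ _ (partial_y u) (partial_y v) z (0, 1) ny).
  move: Exx Eyy; set a := partial_x _ z; set b := partial_y _ z.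
  by set c := partial_x _ z; set d := partial_y _ z => -> ->.
Qed.

Lemma harmonic_on_sub (U V : set (plane R)) u : V `<=` U ->
  harmonic_on U u -> harmonic_on V u.
Proof.
move=> VU [C1u C1ux C1uy Du].
split; [exact: (fun z Vz => C1u z (VU z Vz))|exact: (fun z Vz => C1ux z (VU z Vz))
  |exact: (fun z Vz => C1uy z (VU z Vz))|exact: (fun z Vz => Du z (VU z Vz))].
Qed.

End harmonic_algebra.

Section derivatives_of_log_kernel.
Context {R : realType}.
Variables (x0 x1 y0 y1 : R).
Let X (t : R) := x0 + x1 * t.
Let Y (t : R) := y0 + y1 * t.
Let q t := X t ^+ 2 + Y t ^+ 2.

Let d_affine (a b t : R) : is_derive t 1 (fun t : R => a + b * t) b.
Proof.
have h := is_deriveD (is_derive_cst a t 1) (is_deriveZ b (is_derive_id t 1)).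
by apply: (is_derive_eq h); rewrite add0r; exact: mulr1.
Qed.

Let dq (t : R) : is_derive t 1 q (2 * (X t * x1 + Y t * y1)).
Proof.
have dX := d_affine x0 x1 t; have dY := d_affine y0 y1 t.
have h := is_deriveD (is_deriveM dX dX) (is_deriveM dY dY).
by apply: (is_derive_eq h); rewrite /GRing.scale/= /X /Y; ring.
Qed.

Lemma is_derive_half_ln_sqr (t : R) : 0 < q t ->
  is_derive t 1 (fun t => 2^-1 * ln (q t)) ((X t * x1 + Y t * y1) / q t).
Proof.
move=> q0.
have dln : is_derive (q t) 1 (@ln R) (q t)^-1 by exact: is_derive1_ln.
have h := is_deriveZ 2^-1 (is_derive1_comp dln (dq t)).
apply: (is_derive_eq h); rewrite /GRing.scale/=; field.
by rewrite gt_eqF.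
Qed.

Lemma is_derive_div_sqr (a b t : R) : 0 < q t ->
  is_derive t 1 (fun t => (a * X t + b * Y t) / q t)
    ((a * x1 + b * y1) / q t -
     2 * (a * X t + b * Y t) * (X t * x1 + Y t * y1) / (q t ^+ 2)).
Proof.
move=> q0; have qN0 : q t != 0 by rewrite gt_eqF.
have dX := d_affine x0 x1 t; have dY := d_affine y0 y1 t.
have h := is_deriveM (is_deriveD (is_deriveZ a dX) (is_deriveZ b dY))
  (is_deriveV qN0 (dq t)).
apply: (is_derive_eq h); rewrite /GRing.scale/=.
change (((a * X t + b * Y t) * (- q t ^- 2 * (2 * (X t * x1 + Y t * y1))) +
  (q t)^-1 * (a * x1 + b * y1)) =
  (a * x1 + b * y1) / q t -
     2 * (a * X t + b * Y t) * (X t * x1 + Y t * y1) / (q t ^+ 2)).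
by field.
Qed.

End derivatives_of_log_kernel.

(** * Harmonicity of averaged logarithms *)

Section harmonic_log_kernel.
Context {R : realType}.
Local Notation mu := (@lebesgue_measure R).
Local Notation I01 := (`[0%R, 1%R]%classic : set R).
Variables alpha beta : R -> R.
Hypotheses (alphac : continuous alpha) (betac : continuous beta).

Let X (s : R) (z : plane R) := alpha s + beta s * z.1.
Let Y (s : R) (z : plane R) := beta s * z.2.
(** This is |alpha s + beta s * z|^2 for real alpha and beta.  Two choices are
    needed: alpha = -s, beta = 1 for log |z - s|, and alpha = 1, beta = -s for
    log |1 - s z|, the same kernel read in the chart at infinity. *)
Definition sqr_affine (s : R) (z : plane R) :=
  (alpha s + beta s * z.1) ^+ 2 + (beta s * z.2) ^+ 2.
Let q := sqr_affine.
Let U := [set z | forall s, I01 s -> 0 < sqr_affine s z].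

Let Xc : continuous (fun p : R * plane R => X p.1 p.2).
Proof.
move=> p; rewrite /X; apply: cvgD.
  by apply: continuous_comp; [exact: cvg_fst|exact: alphac].
apply: cvgM; first by apply: continuous_comp; [exact: cvg_fst|exact: betac].
by apply: (@continuous_comp _ _ _ snd fst); [exact: cvg_snd|exact: cvg_fst].
Qed.

Let Yc : continuous (fun p : R * plane R => Y p.1 p.2).
Proof.
move=> p; rewrite /Y.
apply: cvgM; first by apply: continuous_comp; [exact: cvg_fst|exact: betac].
by apply: (@continuous_comp _ _ _ snd snd); [exact: cvg_snd|exact: cvg_snd].
Qed.

Lemma continuous_sqr_affine :
  continuous (fun p : R * plane R => sqr_affine p.1 p.2).
Proof.
by move=> p; apply: cvgD; [apply: cvgM; exact: Xc|apply: cvgM; exact: Yc].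
Qed.

Let qc := continuous_sqr_affine.

(** Openness again comes from the compactness of the unit interval: the
    complement is a union over s of closed sets, which need not be closed for an
    arbitrary parameter set. *)
Lemma open_sqr_affine_gt0 : open U.
Proof.
have near_gt0 (s : R) (z : plane R) : 0 < q s z ->
    \forall s' \near s & z' \near z, 0 < q s' z'.
  move=> q0; have /cvgr_gt/(_ _ q0) := @qc (s, z).
  by case=> -[A B] [/= As Bz] AB; exists (A, B).
rewrite openE => z Uz.
have := @segment_compact R 0 1; move/compact_near_coveringP.
move=> /(_ _ (nbhs z) (fun z' s => 0 < q s z')); apply => s Is.
exact: near_gt0 (Uz s Is).
Qed.

Let bc (p : R * plane R) : {for p, continuous (fun p => beta p.1)}.
Proof. by apply: continuous_comp; [exact: cvg_fst|exact: betac]. Qed.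

Let kc0 (s : R) (z : plane R) : 0 < q s z ->
  {for (s, z), continuous (fun p => 2^-1 * ln (q p.1 p.2))}.
Proof.
move=> q0; apply: cvgM; first exact: cvg_cst.
apply: (@continuous_comp _ _ _ (fun p : R * plane R => q p.1 p.2) (@ln R)).
  exact: qc.
exact: continuous_ln.
Qed.

Let kc (c : R -> plane R -> R) n (s : R) (z : plane R) :
  continuous (fun p => c p.1 p.2) -> 0 < q s z ->
  {for (s, z), continuous (fun p => c p.1 p.2 / q p.1 p.2 ^+ n)}.
Proof.
move=> cc q0; apply: cvgM; first exact: cc.
apply: cvgV; first by rewrite /= expf_neq0// gt_eqF.
elim: n => [|n IH]; first exact: cvg_cst.
rewrite [X in _ --> X]exprS.
under eq_fun do rewrite exprS.
by apply: cvgM => //; exact: qc.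
Qed.

Let cX : continuous (fun p : R * plane R => beta p.1 * X p.1 p.2).
Proof. by move=> p; apply: cvgM; [exact: bc|exact: Xc]. Qed.

Let cY : continuous (fun p : R * plane R => beta p.1 * Y p.1 p.2).
Proof. by move=> p; apply: cvgM; [exact: bc|exact: Yc]. Qed.

Let k0 s z := 2^-1 * ln (q s z).
(* With w = X + i Y, the kernels kx and ky are beta times the real part and minus
   the imaginary part of 1 / w, and kxx, kxy, kyy come from 1 / w^2 in the same
   way; harmonicity is kxx + kyy = 0. *)
Let kx s z := beta s * X s z / q s z ^+ 1.
Let ky s z := beta s * Y s z / q s z ^+ 1.
Let kxx s z := beta s ^+ 2 * (Y s z ^+ 2 - X s z ^+ 2) / q s z ^+ 2.
Let kxy s z := - 2 * beta s ^+ 2 * X s z * Y s z / q s z ^+ 2.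
Let kyy s z := beta s ^+ 2 * (X s z ^+ 2 - Y s z ^+ 2) / q s z ^+ 2.

Let cXX : continuous (fun p : R * plane R => beta p.1 ^+ 2 * (X p.1 p.2 ^+ 2 - Y p.1 p.2 ^+ 2)).
Proof.
move=> p; apply: cvgM; first by apply: cvgM; exact: bc.
by apply: cvgB; apply: cvgM; (exact: Xc || exact: Yc).
Qed.

Let cYY : continuous (fun p : R * plane R => beta p.1 ^+ 2 * (Y p.1 p.2 ^+ 2 - X p.1 p.2 ^+ 2)).
Proof.
move=> p; apply: cvgM; first by apply: cvgM; exact: bc.
by apply: cvgB; apply: cvgM; (exact: Xc || exact: Yc).
Qed.

Let cXY : continuous (fun p : R * plane R => - 2 * beta p.1 ^+ 2 * X p.1 p.2 * Y p.1 p.2).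
Proof.
move=> p; apply: cvgM; last exact: Yc.
apply: cvgM; last exact: Xc.
apply: cvgM; first exact: cvg_cst.
by apply: cvgM; exact: bc.
Qed.

Let lineX s (z v : plane R) (x : R) : X s (z + x *: v) = X s z + beta s * v.1 * x.
Proof. by rewrite /X /= /GRing.scale/=; ring. Qed.

Let lineY s (z v : plane R) (x : R) : Y s (z + x *: v) = Y s z + beta s * v.2 * x.
Proof. by rewrite /Y /= /GRing.scale/=; ring. Qed.

Let is_derive_line (g : plane R -> R) (z v : plane R) d :
  is_derive (0 : R) 1 (fun x : R => g (z + x *: v)) d -> is_derive z v g d.
Proof. by move/is_derive_along_line; rewrite scale0r addr0. Qed.

Let is_derive_k0 s z v d : 0 < q s z ->
  (X s z * (beta s * v.1) + Y s z * (beta s * v.2)) / q s z = d ->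
  is_derive z v (k0 s) d.
Proof.
move=> q0 <-; apply: is_derive_line.
rewrite (_ : (fun x => _) = (fun x => 2^-1 * ln ((X s z + beta s * v.1 * x) ^+ 2 +
    (Y s z + beta s * v.2 * x) ^+ 2))); last first.
  by apply/funext => x; rewrite -lineX -lineY.
have q0' : 0 < (X s z + beta s * v.1 * 0) ^+ 2 + (Y s z + beta s * v.2 * 0) ^+ 2.
  by rewrite !mulr0 !addr0.
apply: (is_derive_eq (is_derive_half_ln_sqr q0')).
by rewrite !mulr0 !addr0.
Qed.

Let is_derive_k1 a b s z v d : 0 < q s z ->
  (a * (beta s * v.1) + b * (beta s * v.2)) / q s z -
     2 * (a * X s z + b * Y s z) * (X s z * (beta s * v.1) + Y s z * (beta s * v.2))
      / q s z ^+ 2 = d ->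
  is_derive z v (fun z => (a * X s z + b * Y s z) / q s z) d.
Proof.
move=> q0 <-; apply: is_derive_line.
rewrite (_ : (fun x => _) = (fun x =>
   (a * (X s z + beta s * v.1 * x) + b * (Y s z + beta s * v.2 * x)) /
  ((X s z + beta s * v.1 * x) ^+ 2 + (Y s z + beta s * v.2 * x) ^+ 2))); last first.
  by apply/funext => x; rewrite -lineX -lineY.
have q0' : 0 < (X s z + beta s * v.1 * 0) ^+ 2 + (Y s z + beta s * v.2 * 0) ^+ 2.
  by rewrite !mulr0 !addr0.
apply: (is_derive_eq (is_derive_div_sqr a b q0')).
by rewrite !mulr0 !addr0.
Qed.

Let kxE s : kx s = (fun z => (beta s * X s z + 0 * Y s z) / q s z).
Proof. by apply/funext => z; rewrite mul0r addr0. Qed.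

Let kyE s : ky s = (fun z => (0 * X s z + beta s * Y s z) / q s z).
Proof. by apply/funext => z; rewrite mul0r add0r. Qed.

Let qE s z : q s z = X s z ^+ 2 + Y s z ^+ 2. Proof. by []. Qed.

Let dkxx s z : 0 < q s z -> is_derive z (1, 0) (kx s) (kxx s z).
Proof.
move=> q0; rewrite kxE; apply: is_derive_k1 => //=; rewrite /kxx qE; field.
by rewrite -qE gt_eqF.
Qed.

Let dkxy s z : 0 < q s z -> is_derive z (0, 1) (kx s) (kxy s z).
Proof.
move=> q0; rewrite kxE; apply: is_derive_k1 => //=; rewrite /kxy qE; field.
by rewrite -qE gt_eqF.
Qed.

Let dkyx s z : 0 < q s z -> is_derive z (1, 0) (ky s) (kxy s z).
Proof.
move=> q0; rewrite kyE; apply: is_derive_k1 => //=; rewrite /kxy qE; field.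
by rewrite -qE gt_eqF.
Qed.

Let dkyy s z : 0 < q s z -> is_derive z (0, 1) (ky s) (kyy s z).
Proof.
move=> q0; rewrite kyE; apply: is_derive_k1 => //=; rewrite /kyy qE; field.
by rewrite -qE gt_eqF.
Qed.

Let dk0x s z : 0 < q s z -> is_derive z (1, 0) (k0 s) (kx s z).
Proof. by move=> q0; apply: is_derive_k0 => //=; rewrite /kx; ring. Qed.

Let dk0y s z : 0 < q s z -> is_derive z (0, 1) (k0 s) (ky s z).
Proof. by move=> q0; apply: is_derive_k0 => //=; rewrite /ky; ring. Qed.

Let integral_of (k : R -> plane R -> R) z := \int[mu]_(s in I01) k s z.

Let joint_on_U (k : R -> plane R -> R) := forall s z, 0 < q s z ->
  {for (s, z), continuous (fun p => k p.1 p.2)}.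

Let near_U z (P : R -> plane R -> Prop) : U z -> (forall s z, 0 < q s z -> P s z) ->
  \forall z' \near z, forall s, I01 s -> P s z'.
Proof.
move=> Uz PP; have := open_nbhs_nbhs (conj open_sqr_affine_gt0 Uz).
by apply: filterS => z' Uz' s Is; apply: PP; exact: Uz'.
Qed.

Let is_derive_integral_of v (k k' : R -> plane R -> R) z :
  joint_on_U k -> joint_on_U k' -> U z ->
  (forall s z, 0 < q s z -> is_derive z v (k s) (k' s z)) ->
  is_derive z v (integral_of k) (integral_of k' z).
Proof.
move=> ck ck' Uz dk; apply: is_derive_Rintegral_unit; exact: near_U.
Qed.

Let continuous_integral_of k z : joint_on_U k -> U z ->
  {for z, continuous (integral_of k)}.
Proof. by move=> ck Uz; apply: continuous_Rintegral_unit; exact: near_U. Qed.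

Let C1_integral_of (k k1 k2 : R -> plane R -> R) :
  joint_on_U k -> joint_on_U k1 -> joint_on_U k2 ->
  (forall s z, 0 < q s z -> is_derive z (1, 0) (k s) (k1 s z)) ->
  (forall s z, 0 < q s z -> is_derive z (0, 1) (k s) (k2 s z)) ->
  [/\ C1_on U (integral_of k),
    forall z, U z -> partial_x (integral_of k) z = integral_of k1 z &
    forall z, U z -> partial_y (integral_of k) z = integral_of k2 z].
Proof.
move=> ck ck1 ck2 dk1 dk2.
have Ex z : U z -> partial_x (integral_of k) z = integral_of k1 z.
  by move=> Uz; have [_ <-] := is_derive_integral_of ck ck1 Uz dk1.
have Ey z : U z -> partial_y (integral_of k) z = integral_of k2 z.
  by move=> Uz; have [_ <-] := is_derive_integral_of ck ck2 Uz dk2.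
split=> // z Uz.
have nU := open_nbhs_nbhs (conj open_sqr_affine_gt0 Uz).
split.
- by have [] := is_derive_integral_of ck ck1 Uz dk1.
- by have [] := is_derive_integral_of ck ck2 Uz dk2.
- change (partial_x (integral_of k) z' @[z' --> z] --> partial_x (integral_of k) z).
  rewrite (Ex z Uz).
  apply: (@cvg_trans _ (integral_of k1 z' @[z' --> z])); last exact: continuous_integral_of.
  by apply: near_eq_cvg; apply: filterS nU => z' /Ex ->.
- change (partial_y (integral_of k) z' @[z' --> z] --> partial_y (integral_of k) z).
  rewrite (Ey z Uz).
  apply: (@cvg_trans _ (integral_of k2 z' @[z' --> z])); last exact: continuous_integral_of.
  by apply: near_eq_cvg; apply: filterS nU => z' /Ey ->.
Qed.

Lemma harmonic_on_log_integral :
  harmonic_on U (fun z => \int[mu]_(s in I01) (2^-1 * ln (sqr_affine s z))).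
Proof.
have ckx : joint_on_U kx by move=> s z; exact: (@kc (fun s z => beta s * X s z) 1%N s z cX).
have cky : joint_on_U ky by move=> s z; exact: (@kc (fun s z => beta s * Y s z) 1%N s z cY).
have ckxx : joint_on_U kxx by move=> s z; exact: (@kc (fun s z => beta s ^+ 2 * (Y s z ^+ 2 - X s z ^+ 2)) 2%N s z cYY).
have ckxy : joint_on_U kxy by move=> s z; exact: (@kc (fun s z => - 2 * beta s ^+ 2 * X s z * Y s z) 2%N s z cXY).
have ckyy : joint_on_U kyy by move=> s z; exact: (@kc (fun s z => beta s ^+ 2 * (X s z ^+ 2 - Y s z ^+ 2)) 2%N s z cXX).
have [C0 Ex Ey] := C1_integral_of kc0 ckx cky dk0x dk0y.
have [Cx Exx _] := C1_integral_of ckx ckxx ckxy dkxx dkxy.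
have [Cy _ Eyy] := C1_integral_of cky ckxy ckyy dkyx dkyy.
have oU := open_sqr_affine_gt0.
rewrite -[X in harmonic_on _ X]/(integral_of k0); split.
- exact: C0.
- exact: (C1_on_eq oU (fun z Uz => esym (Ex z Uz)) Cx).
- exact: (C1_on_eq oU (fun z Uz => esym (Ey z Uz)) Cy).
- move=> z Uz; have nU := open_nbhs_nbhs (conj oU Uz).
  have nEx : {near z, partial_x (integral_of k0) =1 integral_of kx}.
    by apply: filterS nU => z' /Ex.
  have nEy : {near z, partial_y (integral_of k0) =1 integral_of ky}.
    by apply: filterS nU => z' /Ey.
  have -> : partial_x (partial_x (integral_of k0)) z = integral_of kxx z.
    by rewrite [LHS](near_eq_derive _ nEx) -(Exx z Uz).
  have -> : partial_y (partial_y (integral_of k0)) z = integral_of kyy z.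
    by rewrite [LHS](near_eq_derive _ nEy) -(Eyy z Uz).
  have jslice k : joint_on_U k -> mu.-integrable I01 (EFin \o k ^~ z).
    by move=> jk; apply: integrable_slice => s Is; apply: jk; exact: Uz.
  rewrite /integral_of -RintegralD//; [|exact: jslice..].
  rewrite [LHS](_ : _ = \int[mu]_(s in I01) cst 0 s); last first.
    by apply: eq_Rintegral => s _; rewrite /kxx /kyy -mulrDl -mulrDr addrC addrA subrK subrr mulr0 mul0r.
  by rewrite Rintegral_cst// mul0r.
Qed.

End harmonic_log_kernel.

(** * The truncated logarithmic kernel *)

Section log_kernel.
Context {R : realType}.
Implicit Types (D v w : R) (z : plane R).
Local Notation mu := (@lebesgue_measure R).
Local Notation I01 := (`[0%R, 1%R]%classic : set R).

Lemma cvg_EFin_comp {T : Type} {F : set_system T} {FF : Filter F} (g : T -> R) (l : R) :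
  g x @[x --> F] --> l -> (g x)%:E @[x --> F] --> l%:E.
Proof. by move=> gl P /= /nbhs_EFin /gl; rewrite !near_simpl. Qed.

(** The truncation at 0 makes the kernel nonnegative, as Tonelli's theorem and
    Fatou's lemma want it; it is invisible as long as log v <= D. *)
Definition logker D v : \bar R :=
  if v <= 0 then +oo%E else (Num.max 0 (D - ln v))%:E.

Lemma logker_ge0 D v : (0 <= logker D v)%E.
Proof. by rewrite /logker; case: ifP => // _; rewrite lee_fin le_max lexx. Qed.

Lemma logker_gt0E D v : 0 < v -> logker D v = (Num.max 0 (D - ln v))%:E.
Proof. by move=> v0; rewrite /logker leNgt v0. Qed.

Lemma logkerE D v : 0 < v -> ln v <= D -> logker D v = (D - ln v)%:E.
Proof. by move=> v0 vD; rewrite logker_gt0E//; congr EFin; apply/max_idPr; rewrite subr_ge0. Qed.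

Lemma logker_le D v w : v <= w -> (logker D w <= logker D v)%E.
Proof.
move=> vw; rewrite /logker; have [v0|v0] := leP v 0; first exact: leey.
have w0 := lt_le_trans v0 vw; rewrite [w <= 0]leNgt w0/= lee_fin.
rewrite ge_max le_max lexx/= le_max; apply/orP; right.
by rewrite lerD2l lerN2 ler_ln.
Qed.

(** Continuity includes the point 0, where the kernel tends to +oo. *)
Lemma continuous_logker D : continuous (logker D).
Proof.
move=> v; rewrite /continuous_at; have [v0|v0] := leP v 0.
  rewrite {2}/logker v0; apply/cvgeyPge => A.
  have : v < expR (D - A) by rewrite (le_lt_trans v0)// expR_gt0.
  move/lt_nbhsl_lt; apply: filterS => w wv.
  have [w0|w0] := leP w 0; first by rewrite /logker w0 leey.
  rewrite logker_gt0E// lee_fin le_max; apply/orP; right.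
  by rewrite lerBrDr -lerBrDl -ler_expR (lnK w0) ltW// wv// (le_trans v0)// ltW.
rewrite logker_gt0E//.
apply: (@cvg_trans _ ((Num.max 0 (D - ln w))%:E @[w --> v])).
  apply: near_eq_cvg; near=> w; rewrite logker_gt0E//.
  by near: w; exact: lt_nbhsr.
have maxc : Num.max 0 (D - ln w) @[w --> v] --> Num.max 0 (D - ln v).
  apply: (@continuous_max R _ (cst 0) (fun w => D - ln w) v); first exact: cvg_cst.
  by apply: cvgB; [exact: cvg_cst|exact: continuous_ln].
exact: (cvg_EFin_comp maxc).
Unshelve. all: by end_near. Qed.

Lemma measurable_logker D : measurable_fun [set: R] (logker D).
Proof.
apply: measurable_fun_ifT => //=; first exact: measurable_fun_ler.
apply/measurable_EFinP; apply: measurable_maxr => //.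
by apply: measurable_funB => //; exact: measurable_ln.
Qed.

(** A discrete layer-cake bound: if n < D - log v then v < expR D / 2 ^ n, because
    2 < e, so the number of nonzero terms is at least D - log v.  It replaces the
    integral of the logarithm near its singularity by lengths of intervals. *)
Lemma logker_le_dyadic D v :
  (logker D v <= \sum_(n <oo) (\1_[set w | w < expR D / 2 ^+ n] v)%:E)%E.
Proof.
set S := (X in (_ <= X)%E).
have ind0 n (_ : xpredT n) : (0 <= (\1_[set w | w < expR D / 2 ^+ n] v)%:E :> \bar R)%E by [].
(* Testing against real T below the kernel also covers the value +oo. *)
have key (T : R) : (T%:E <= logker D v)%E -> 0 <= T -> (T%:E <= S)%E.
  move=> Tv T0; apply: (@le_trans _ _ (\sum_(0 <= n < Num.truncn T + 1) (\1_[set w | w < expR D / 2 ^+ n] v)%:E)%E); last first.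
    exact: nneseries_lim_ge.
  have [->|TN0] := eqVneq T 0; first by rewrite sume_ge0.
  have Tp : 0 < T by rewrite lt_neqAle eq_sym TN0.
  have /andP[NT TN] := Num.Theory.truncn_itv T0.
  rewrite addn1 (eq_big_nat _ _ (F2 := fun=> 1%:E)) => [|i /andP[_ iN]].
    by rewrite sumEFin big_const_nat subn0 iter_addr_0 lee_fin ltW.
  congr EFin; rewrite indicE mem_set//=.
  have [v0|v0] := leP v 0; first by rewrite (le_lt_trans v0)// divr_gt0// ?expR_gt0// exprn_gt0.
  move: Tv; rewrite logker_gt0E// lee_fin le_max leNgt Tp/= => Tv.
  have vT : v <= expR D / expR T.
    by rewrite -expRN -expRD -[leLHS]lnK// ler_expR lerBrDl addrC -lerBrDl.
  apply: (le_lt_trans vT); rewrite ltr_pM2l ?expR_gt0// ltf_pV2 ?posrE ?expR_gt0 ?exprn_gt0//.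
  case: i iN => [|i] iN; first by rewrite expr0 expR_gt1.
  have e2 : 2 < expR 1 :> R by rewrite (_ : 2 = 1 + 1)// expR_gt1Dx// oner_neq0.
  have lt_e : 2 ^+ i.+1 < expR i.+1%:R :> R.
    by rewrite -[i.+1%:R]mulr1 expRM_natl ltrXn2r// ltW.
  apply: (lt_le_trans lt_e); rewrite ler_expR (le_trans _ NT)// ler_nat.
  by rewrite -ltnS.
case E : (logker D v) => [T| |].
- by apply: key; rewrite ?E// -lee_fin -E logker_ge0.
- rewrite leye_eq; apply/eqP/eq_infty => T.
  have [T0|T0] := leP 0 T; first by apply: key; rewrite ?E ?leey.
  by rewrite (@le_trans _ _ 0%E) ?lee_fin ?(ltW T0)// nneseries_ge0.
- by have := logker_ge0 D v; rewrite E.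
Qed.

End log_kernel.

Section modulus_and_singular_bound.
Context {R : realType}.
Implicit Types (D v w : R) (z : plane R).
Local Notation mu := (@lebesgue_measure R).
Local Notation I01 := (`[0%R, 1%R]%classic : set R).

Definition modulus z : R := Num.sqrt (z.1 ^+ 2 + z.2 ^+ 2).

Lemma log_absE z : log_abs (toC z) = lne (modulus z)%:E.
Proof. by []. Qed.

Lemma modulus_ge0 z : 0 <= modulus z. Proof. exact: sqrtr_ge0. Qed.

Lemma continuous_modulus : continuous modulus.
Proof.
move=> z; apply: (@continuous_comp _ _ _ (fun z : plane R => z.1 ^+ 2 + z.2 ^+ 2) Num.sqrt).
  apply: cvgD; first by apply: cvgM; exact: cvg_fst.
  by apply: cvgM; exact: cvg_snd.
exact: sqrt_continuous.
Qed.

Lemma modulus_eq0 z : (modulus z == 0) = (z == 0).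
Proof.
case: z => x y; rewrite /modulus/= sqrtr_eq0 le_eqVlt ltNge addr_ge0 ?sqr_ge0// orbF.
by rewrite paddr_eq0 ?sqr_ge0// !sqrf_eq0.
Qed.

Lemma normr_le_modulus z : `|z.1| <= modulus z.
Proof. by rewrite -sqrtr_sqr ler_wsqrtr// lerDl sqr_ge0. Qed.

Lemma ln_modulusE z : ln (modulus z) = 2^-1 * ln (z.1 ^+ 2 + z.2 ^+ 2).
Proof.
have [q0|q0] := leP (z.1 ^+ 2 + z.2 ^+ 2) 0.
  by rewrite /modulus ler0_sqrtr// !ln0 ?mulr0.
rewrite -[in RHS](sqr_sqrtr (ltW q0)) -/(modulus z) lnXn ?sqrtr_gt0//.
by rewrite -[X in 2^-1 * X]mulr_natl mulKf// pnatr_eq0.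
Qed.

Lemma measurable_modulus : measurable_fun setT modulus.
Proof.
rewrite (_ : modulus = Num.sqrt \o (fun z : plane R => z.1 ^+ 2 + z.2 ^+ 2))//.
apply: measurableT_comp; first exact: continuous_measurable_fun (@sqrt_continuous R).
by apply: measurable_funD; apply: measurable_funX.
Qed.

(** In the dyadic bound, each term contributes at most the length
    2 * expR D / 2 ^ n / `|r| of an interval, and these sum to 4 * expR D / `|r|. *)
Lemma integral_logker_segment_le D (x r : R) : r != 0 ->
  (\int[mu]_(th in I01) logker D `|x - th * r|%R <= (4 * expR D / `|r|)%:E)%E.
Proof.
move=> r0; have r_gt0 : 0 < `|r| by rewrite normr_gt0.
have mabs : measurable_fun I01 (fun th => `|x - th * r|).
  apply: measurable_funTS; apply: measurableT_comp => //.
  by apply: measurable_funB => //; apply: measurable_funM.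
pose f n (th : R) : \bar R := (\1_[set w : R | w < expR D / 2 ^+ n] `|x - th * r|)%:E.
have mset n : measurable [set w : R | w < expR D / 2 ^+ n].
  by rewrite -[X in measurable X]/[set` `]-oo, (expR D / 2 ^+ n)[].
have mf n : measurable_fun I01 (f n).
  apply/measurable_EFinP; apply: (@measurable_comp _ _ _ _ _ _ setT) => //.
have fint n : (\int[mu]_(th in I01) f n th <= (4 * expR D / `|r| / (2 ^ (n + 1))%:R)%:E)%E.
  pose B := ball (x / r) (expR D / 2 ^+ n / `|r|).
  have mB : measurable B by exact: measurable_ball.
  apply: (@le_trans _ _ (\int[mu]_(th in I01) (\1_B th)%:E)%E).
    apply: ge0_le_integral => //; first by move=> th _; rewrite lee_fin.
      exact: (mf n).
      by apply/measurable_EFinP; exact: measurable_indic.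
    move=> th _; rewrite /f !indicE lee_fin.
    have [H|H] := pselect ([set w : R | w < expR D / 2 ^+ n] `|x - th * r|); last first.
      by rewrite (memNset H) ler0n.
    rewrite (mem_set H) mem_set// /B -ball_normE/= ltr_pdivlMr// -normrM.
    by rewrite mulrBl divfK.
  rewrite integral_indic//.
  apply: (@le_trans _ _ (mu B)); first by apply: le_measure; rewrite ?inE//; exact: measurableI.
  rewrite /B lebesgue_measure_ball; last by rewrite !divr_ge0// ?expR_ge0// exprn_ge0.
  rewrite lee_fin natrX exprD expr1 mulr2n le_eqVlt; apply/orP; left; apply/eqP.
  by field; rewrite normr_eq0 r0 expf_neq0 ?pnatr_eq0.
apply: (@le_trans _ _ (\int[mu]_(th in I01) (\sum_(n <oo) f n th))%E).
  apply: ge0_le_integral => //.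
  - by move=> th _; exact: logker_ge0.
  - by apply: (@measurable_comp _ _ _ _ _ _ setT) => //; exact: measurable_logker.
  - apply: (@ge0_emeasurable_sum _ _ _ I01 f xpredT); first by move=> n th _ _; rewrite lee_fin.
    by move=> n _; exact: mf.
  - by move=> th _; exact: logker_le_dyadic.
rewrite integral_nneseries//; last by move=> n th _; rewrite lee_fin.
have cv := @cvg_geometric_eseries_half R (4 * expR D / `|r|) 0.
rewrite expr0 divr1 in cv.
rewrite -(cvg_lim _ cv)//.
apply: lee_nneseries => [n _ _|n _]; last exact: fint.
by apply: integral_ge0 => th _; rewrite lee_fin.
Qed.

End modulus_and_singular_bound.

(** * Logarithmic potential of a segment *)

Section segment_potential.
Context {R : realType}.
Local Notation mu := (@lebesgue_measure R).
Local Notation I01 := (`[0%R, 1%R]%classic : set R).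
Variables c r : R.
Hypothesis r0 : r != 0.
Implicit Types (D d v w th : R) (z : plane R).

Let rho th z := modulus (z - ofR (c + th * r)).

Definition segpot z := \int[mu]_(th in I01) ln (modulus (z - ofR (c + th * r))).

Lemma continuous_dist_segment :
  continuous (fun p : R * plane R => modulus (p.2 - ofR (c + p.1 * r))).
Proof.
move=> p.
apply: (@continuous_comp _ _ _ (fun p : R * plane R => p.2 - ofR (c + p.1 * r)) modulus); last exact: continuous_modulus.
apply: cvgB; first exact: cvg_snd.
apply: (@cvg_pair _ _ _ (nbhs p) (nbhs (c + p.1 * r)) (nbhs (0 : R))); last exact: cvg_cst.
apply: cvgD; first exact: cvg_cst.
by apply: cvgM; [exact: cvg_fst|exact: cvg_cst].
Qed.

Let continuous_rho z : continuous (rho ^~ z).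
Proof. by move=> th; apply: continuous_at_slice; exact: continuous_dist_segment. Qed.

Let measurable_rho z : measurable_fun setT (rho ^~ z).
Proof. exact: (continuous_measurable_fun (@continuous_rho z)). Qed.

(** The distance to a real point is at least the distance from the real part, so
    the bound on the line applies. *)
Lemma integral_logker_dist_le D z :
  (\int[mu]_(th in I01) logker D (modulus (z - ofR (c + th * r))%R) <= (4 * expR D / `|r|)%:E)%E.
Proof.
apply: le_trans (integral_logker_segment_le D (z.1 - c) r0).
apply: ge0_le_integral => //.
- by move=> th _; exact: logker_ge0.
- apply: measurable_funTS; apply: measurableT_comp; [exact: measurable_logker|exact: measurable_rho].
- apply: measurable_funTS; apply: measurableT_comp; first exact: measurable_logker.
  apply: measurableT_comp => //; apply: measurable_funB => //.
  exact: measurable_funM.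
- move=> th _; apply: logker_le; rewrite -addrA -opprD.
  exact: normr_le_modulus (z - ofR (c + th * r)).
Qed.

(* The logarithm cut off below at d.  It is continuous, and by the singular bound
   its average over the segment differs from segpot by at most 4 * expR d / `|r|,
   uniformly in z. *)
Let trunc d v := ln (Num.max v (expR d)).

Let continuous_trunc d : continuous (trunc d).
Proof.
move=> v; apply: (@continuous_comp _ _ _ (fun v => Num.max v (expR d)) (@ln R)).
  by apply: (@continuous_max R _ id (cst (expR d)) v); [exact: cvg_id|exact: cvg_cst].
by apply: continuous_ln; rewrite lt_max expR_gt0 orbT.
Qed.

Let trunc_sub_le d v : 0 <= v -> (`|trunc d v - ln v|%:E <= logker d v)%E.
Proof.
rewrite le_eqVlt => /predU1P[<-|v0]; first by rewrite /logker lexx leey.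
rewrite logker_gt0E// lee_fin /trunc.
have [vd|vd] := leP v (expR d).
  rewrite expRK le_max; apply/orP; right; rewrite ger0_norm// subr_ge0.
  by rewrite -ler_expR lnK.
by rewrite subrr normr0 le_max lexx.
Qed.

Let integrable_trunc d z : mu.-integrable I01 (EFin \o (fun th => trunc d (rho th z))).
Proof.
apply: integrable_unit_itv; apply: continuous_subspaceT => th.
apply: (@continuous_comp _ _ _ (rho ^~ z) (trunc d)); first exact: continuous_rho.
exact: continuous_trunc.
Qed.

Let measurable_ln_rho z : measurable_fun I01 (fun th => ln (rho th z)).
Proof.
by apply: measurable_funTS; apply: measurableT_comp; [exact: measurable_ln|exact: measurable_rho].
Qed.

Let measurable_trunc_sub d z :
  measurable_fun I01 (fun th => trunc d (rho th z) - ln (rho th z)).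
Proof.
apply: measurable_funB; last exact: measurable_ln_rho.
by have /integrableP[/measurable_EFinP] := integrable_trunc d z.
Qed.

Let integral_trunc_sub_le d z :
  (\int[mu]_(th in I01) `|(trunc d (rho th z) - ln (rho th z))%R%:E| <= (4 * expR d / `|r|)%:E)%E.
Proof.
apply: le_trans (integral_logker_dist_le d z).
apply: ge0_le_integral => //.
- by apply: measurableT_comp => //; apply/measurable_EFinP; exact: measurable_trunc_sub.
- apply: measurable_funTS; apply: measurableT_comp; [exact: measurable_logker|exact: measurable_rho].
- by move=> th _; rewrite abse_EFin; apply: trunc_sub_le; exact: modulus_ge0.
Qed.

Let integrable_trunc_sub d z :
  mu.-integrable I01 (EFin \o (fun th => trunc d (rho th z) - ln (rho th z))).
Proof.
apply/integrableP; split; first by apply/measurable_EFinP; exact: measurable_trunc_sub.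
exact: le_lt_trans (integral_trunc_sub_le d z) (ltry _).
Qed.

Lemma integrable_ln_dist z :
  mu.-integrable I01 (EFin \o (fun th => ln (modulus (z - ofR (c + th * r))))).
Proof.
have mI : measurable I01 by [].
have := @integrableB _ _ _ mu _ mI _ _ (integrable_trunc 0 z) (integrable_trunc_sub 0 z).
by apply: eq_integrable => // th _ /=; rewrite -EFinB subKr.
Qed.

Let trunc_segpot d z : `| \int[mu]_(th in I01) trunc d (rho th z) - segpot z | <= 4 * expR d / `|r|.
Proof.
rewrite /segpot -RintegralB//; last exact: integrable_ln_dist.
rewrite -lee_fin EFin_normr_Rintegral//.
apply: le_trans (le_abse_integral _ _ _) (integral_trunc_sub_le d z) => //.
by apply/measurable_EFinP; exact: measurable_trunc_sub.
Qed.

(** A uniform limit of averages of truncated logarithms, which are continuous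
    because their kernel is. *)
Lemma continuous_segpot : continuous segpot.
Proof.
have rp : 0 < `|r| by rewrite normr_gt0.
move=> z; apply/cvgrPdist_le => e e0.
(* The cut-off for which 4 * expR d / `|r| = e / 3. *)
pose d := ln (e * `|r| / 12).
have d0 : 0 < e * `|r| / 12 by rewrite divr_gt0// mulr_gt0.
have Ed z' : `| \int[mu]_(th in I01) trunc d (rho th z') - segpot z' | <= e / 3.
  apply: (le_trans (trunc_segpot d z')); rewrite /d lnK//.
  rewrite le_eqVlt; apply/orP; left; apply/eqP; field.
  by rewrite gt_eqF.
have e3 : 0 < e / 3 by rewrite divr_gt0.
have : {for z, continuous (fun z' => \int[mu]_(th in I01) trunc d (rho th z'))}.
  apply: continuous_Rintegral_unit; near=> z' => s _.
  apply: (@continuous_comp _ _ _ (fun p : R * plane R => rho p.1 p.2) (trunc d)).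
    exact: continuous_dist_segment.
  exact: continuous_trunc.
move/cvgrPdist_le => /(_ _ e3); apply: filterS => z' h.
have tri (p q s t : R) : p - q = - (s - p) + (s - t) + (t - q) by ring.
rewrite (tri _ _ (\int[mu]_(th in I01) trunc d (rho th z))
  (\int[mu]_(th in I01) trunc d (rho th z'))).
rewrite (_ : e = e / 3 + e / 3 + e / 3); last by field.
apply: (le_trans (ler_normD _ _)); apply: lerD => //.
by apply: (le_trans (ler_normD _ _)); apply: lerD => //; rewrite normrN.
Unshelve. all: by end_near. Qed.

(** The kernel is D - ln except at the parameter where z is met, if there is one:
    there the kernel is +oo whereas ln 0 = 0 by convention. *)
Lemma integral_logker_dist D z :
  (forall th, I01 th -> ln (modulus (z - ofR (c + th * r))) <= D) ->
  (\int[mu]_(th in I01) logker D (modulus (z - ofR (c + th * r))%R) = (D - segpot z)%R%:E)%E.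
Proof.
move=> hD.
have iD : mu.-integrable I01 (EFin \o cst D).
  by apply: integrable_unit_itv; apply: continuous_subspaceT => x; exact: cvg_cst.
transitivity (\int[mu]_(th in I01) (D - ln (rho th z))%R%:E)%E.
  apply: ae_eq_integral => //.
  - apply: measurable_funTS; apply: measurableT_comp; [exact: measurable_logker|exact: measurable_rho].
  - by apply/measurable_EFinP; apply: measurable_funB => //; exact: measurable_ln_rho.
  - exists [set (z.1 - c) / r]; split => //=; first exact: lebesgue_measure_set1.
    move=> th /= /not_implyP[Ith]; apply: contra_notP => /eqP thN.
    rewrite logkerE//; last exact: hD.
    rewrite lt_neqAle modulus_ge0 andbT eq_sym modulus_eq0.
    apply: contraNneq thN => -[/eqP + _]; rewrite subr_eq0 => /eqP ->.
    by rewrite addrAC subrr add0r mulfK.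
have segpotE : (segpot z)%:E = (\int[mu]_(th in I01) (ln (rho th z))%:E)%E.
  rewrite fineK//; exact: integrable_fin_num (integrable_ln_dist z).
rewrite EFinB segpotE.
under eq_integral do rewrite EFinB.
rewrite integralB//; last exact: integrable_ln_dist.
by rewrite integral_cst//= lebesgue_measure_itv/= lte01 oppr0 adde0 mule1.
Qed.

Lemma harmonic_on_segpot :
  harmonic_on (~` [set ofR (c + th * r) | th in I01]) segpot.
Proof.
pose al th := - (c + th * r).
have alc : continuous al.
  move=> th; apply: cvgN; apply: cvgD; first exact: cvg_cst.
  by apply: cvgM; [exact: cvg_id|exact: cvg_cst].
have bec : continuous (cst 1 : R -> R) by move=> th; exact: cvg_cst.
have E z th : (z - ofR (c + th * r)).1 ^+ 2 + (z - ofR (c + th * r)).2 ^+ 2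
   = sqr_affine al (cst 1) th z.
  by rewrite /sqr_affine /al /= oppr0 addr0 !mul1r (addrC z.1).
have -> : segpot = (fun z => \int[mu]_(th in I01) (2^-1 * ln (sqr_affine al (cst 1) th z))).
  apply/funext => z; apply: eq_Rintegral => th _.
  by rewrite ln_modulusE E.
apply: harmonic_on_sub (harmonic_on_log_integral alc bec) => z zN th Ith /=.
rewrite -E lt_neqAle addr_ge0 ?sqr_ge0// andbT eq_sym; apply/negP => /eqP q0.
apply: zN; exists th => //; apply/esym/eqP; rewrite -subr_eq0 -modulus_eq0.
by rewrite /modulus q0 sqrtr0.
Qed.

End segment_potential.

(** * Segment potentials on the sphere and the Dirichlet problem *)

Section far_field.
Context {R : realType}.
Local Notation mu := (@lebesgue_measure R).
Local Notation I01 := (`[0%R, 1%R]%classic : set R).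
Variables c r : R.
Hypothesis r0 : r != 0.
Implicit Types (z : plane R).

(** For |s| <= |z| / 4 the squared distances |z - s|^2 and |z|^2 differ by a factor
    at most 4, by 2 |z.1 s| <= z.1^2 / 4 + 4 s^2. *)
Lemma segpot_far (B : R) z : 0 < B -> (forall th, I01 th -> `|c + th * r| <= B / 4) ->
  B <= modulus z -> `|segpot c r z - ln (modulus z)| <= ln 4.
Proof.
move=> B0 hB Bz; have z0 : 0 < modulus z by exact: lt_le_trans Bz.
have icst : mu.-integrable I01 (EFin \o cst (ln (modulus z))).
  by apply: integrable_unit_itv; apply: continuous_subspaceT => x; exact: cvg_cst.
have -> : segpot c r z - ln (modulus z) =
    \int[mu]_(th in I01) (ln (modulus (z - ofR (c + th * r))) - cst (ln (modulus z)) th).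
  rewrite RintegralB//; last exact: integrable_ln_dist.
  rewrite Rintegral_cst//; congr (_ - _).
  by rewrite [X in _ * fine X]lebesgue_measure_itv/= lte01 oppr0 adde0 mulr1.
have mI : measurable I01 by [].
apply: le_norm_Rintegral_unit.
  have := @integrableB _ _ _ mu _ mI _ _ (integrable_ln_dist c r0 z) icst.
  by apply: eq_integrable.
move=> th Ith /=; have := hB _ Ith; move: (c + th * r) => s sB.
set q := z.1 ^+ 2 + z.2 ^+ 2.
have q0 : 0 < q by rewrite -sqrtr_gt0.
have sq : 16 * s ^+ 2 <= q.
  have -> : q = modulus z ^+ 2 by rewrite sqr_sqrtr// ltW.
  have -> : 16 * s ^+ 2 = (4 * `|s|) ^+ 2 by rewrite exprMn real_normK ?num_real// -natrX.
  have sz : 4 * `|s| <= modulus z.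
    by apply: (le_trans _ Bz); rewrite mulrC -ler_pdivlMr.
  by rewrite ler_sqr// nnegrE ?mulr_ge0// ltW.
have h1 : 0 <= (z.1 / 2 - 2 * s) ^+ 2 by exact: sqr_ge0.
have h2 : 0 <= (z.1 / 2 + 2 * s) ^+ 2 by exact: sqr_ge0.
have h3 : 0 <= z.2 ^+ 2 by exact: sqr_ge0.
rewrite !ln_modulusE -/q /=.
set q' := _ ^+ 2 + _ ^+ 2.
have q'E : q' = q - 2 * z.1 * s + s ^+ 2 by rewrite /q' /q; ring.
have h4 : 0 <= s ^+ 2 by exact: sqr_ge0.
have q'1 : q' <= 4 * q by rewrite q'E; rewrite /q in sq *; nra.
have q'2 : q <= 4 * q' by rewrite q'E; rewrite /q in sq *; nra.
have q'0 : 0 < q' by rewrite -(@pmulr_rgt0 _ 4)// (lt_le_trans q0).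
have l1 : ln q' <= ln 4 + ln q by rewrite -lnM ?posrE// ler_ln// posrE mulr_gt0.
have l2 : ln q <= ln 4 + ln q' by rewrite -lnM ?posrE// ler_ln// posrE mulr_gt0.
have l4 : 0 <= ln 4 :> R by rewrite ln_ge0// ler1n.
rewrite ler_norml; apply/andP; split; lra.
Qed.

End far_field.

Section chart.
Context {R : realType}.
Implicit Types (z : plane R).

Lemma ofC_invE z : ofC (toC z)^-1 =
  (z.1 / (z.1 ^+ 2 + z.2 ^+ 2), - (z.2 / (z.1 ^+ 2 + z.2 ^+ 2))).
Proof. by case: z => x y. Qed.

Lemma sqr_norm_gt0 z : z != 0 -> 0 < z.1 ^+ 2 + z.2 ^+ 2.
Proof. by move=> z0; rewrite -sqrtr_gt0 lt_neqAle modulus_ge0 eq_sym modulus_eq0 z0. Qed.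

(** The identity |1 / z - s| = |1 - s z| / |z| behind the change of chart. *)
Lemma sqr_dist_inv z (s : R) : z != 0 ->
  (ofC (toC z)^-1 - ofR s).1 ^+ 2 + (ofC (toC z)^-1 - ofR s).2 ^+ 2 =
  ((1 - s * z.1) ^+ 2 + (- s * z.2) ^+ 2) / (z.1 ^+ 2 + z.2 ^+ 2).
Proof. by move=> /sqr_norm_gt0 n0; rewrite ofC_invE/=; field; rewrite gt_eqF. Qed.

End chart.

Section dirichlet_solution_of_segments.
Context {R : realType}.
Local Notation mu := (@lebesgue_measure R).
Local Notation I01 := (`[0%R, 1%R]%classic : set R).
Variables c1 r1 c2 r2 : R.
Hypotheses (r10 : r1 != 0) (r20 : r2 != 0).
Variable K : set (plane R).
Hypothesis K1 : forall th, I01 th -> K (ofR (c1 + th * r1)).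
Hypothesis K2 : forall th, I01 th -> K (ofR (c2 + th * r2)).
Implicit Types (z : plane R).

(** The value 0 at infinity is the limit: both potentials are log |z| + o(1). *)
Definition segpot_diff (w : sphere R) : R :=
  if w is Some z then segpot c1 r1 z - segpot c2 r2 z else 0.

(* The segment potential in the chart at infinity, up to the term log |z|. *)
Let chartpot (c r : R) z :=
  \int[mu]_(th in I01) (2^-1 * ln (sqr_affine (cst 1) (fun th => - (c + th * r)) th z)).

Let opp_segc (c r : R) : continuous (fun th : R => - (c + th * r)).
Proof.
move=> th; apply: cvgN; apply: cvgD; first exact: cvg_cst.
by apply: cvgM; [exact: cvg_id|exact: cvg_cst].
Qed.

Let onec : continuous (cst 1 : R -> R). Proof. by move=> th; exact: cvg_cst. Qed.

Let V (c r : R) := [set z | forall th, I01 th ->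
  0 < sqr_affine (cst 1) (fun th => - (c + th * r)) th z].

Let openV (c r : R) : open (V c r).
Proof. exact: (open_sqr_affine_gt0 (@onec) (@opp_segc c r)). Qed.

Let chart_in_V (c r : R) z :
  (forall th, I01 th -> K (ofR (c + th * r))) ->
  ~ (Some @` K) (chart_infty z) -> V c r z.
Proof.
move=> Kcr zK th Ith /=; rewrite /chart_infty in zK.
move: zK; case: eqP => [->|/eqP z0] zK.
  by rewrite /sqr_affine/= !mulr0 expr0n/= !addr0 expr1n.
have q0 := sqr_norm_gt0 z0.
have -> : sqr_affine (cst 1) (fun th => - (c + th * r)) th z =
    (1 - (c + th * r) * z.1) ^+ 2 + (- (c + th * r) * z.2) ^+ 2.
  by rewrite /sqr_affine/= mulNr.
have n0 : 0 < (z.1 ^+ 2 + z.2 ^+ 2)^-1 by rewrite invr_gt0.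
rewrite -(pmulr_lgt0 _ n0) -sqr_dist_inv// -sqrtr_gt0.
rewrite -/(modulus _) lt_neqAle modulus_ge0 andbT eq_sym modulus_eq0 subr_eq0.
by apply: contra_notN zK => /eqP ->; exists (ofR (c + th * r)) => //; exact: Kcr.
Qed.

Let segpot_chart (c r : R) z : r != 0 -> z != 0 -> V c r z ->
  segpot c r (ofC (toC z)^-1) = chartpot c r z - 2^-1 * ln (z.1 ^+ 2 + z.2 ^+ 2).
Proof.
move=> rN0 z0 Vz; have q0 := sqr_norm_gt0 z0.
pose L := 2^-1 * ln (z.1 ^+ 2 + z.2 ^+ 2).
transitivity (\int[mu]_(th in I01)
    (2^-1 * ln (sqr_affine (cst 1) (fun th => - (c + th * r)) th z) - cst L th)).
  apply: eq_Rintegral => th /set_mem Ith.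
  rewrite ln_modulusE sqr_dist_inv// /L /= -mulrBr -ln_div ?posrE//; last exact: Vz.
  by rewrite /sqr_affine/= !mulNr.
rewrite RintegralB//.
- by rewrite Rintegral_cst// [X in _ * fine X]lebesgue_measure_itv/= lte01 oppr0 adde0 mulr1.
- apply: (@integrable_slice _ _ (fun th z => 2^-1 * ln (sqr_affine (cst 1) (fun th => - (c + th * r)) th z))).
  move=> s Is; apply: cvgM; first exact: cvg_cst.
  apply: (@continuous_comp _ _ _ (fun p : R * plane R => sqr_affine (cst 1) (fun th => - (c + th * r)) p.1 p.2) (@ln R)).
    exact: (continuous_sqr_affine (@onec) (@opp_segc c r)).
  by apply: continuous_ln; exact: Vz.
- by apply: integrable_unit_itv; apply: continuous_subspaceT => x; exact: cvg_cst.
Qed.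

(** In the chart at infinity the two terms log |z| cancel, leaving a difference of
    averages of log |1 - s z|, which is harmonic also at z = 0. *)
Lemma segpot_diff_harmonic (W : set (sphere R)) : W `<=` ~` (Some @` K) ->
  sphere_harmonic W segpot_diff.
Proof.
move=> WK.
have plane_part : harmonic_on (~` [set ofR (c1 + th * r1) | th in I01] `&`
    ~` [set ofR (c2 + th * r2) | th in I01]) (segpot c1 r1 \- segpot c2 r2).
  have closed_seg (c r : R) : open (~` [set ofR (c + th * r) | th in I01] : set (plane R)).
    apply: closed_openC; apply: compact_closed; first exact: norm_hausdorff.
    apply: continuous_compact; last exact: segment_compact.
    apply: continuous_subspaceT => th.
    apply: (@cvg_pair _ _ _ (nbhs th) (nbhs (c + th * r)) (nbhs (0 : R))); last exact: cvg_cst.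
    apply: cvgD; first exact: cvg_cst.
    by apply: cvgM; [exact: cvg_id|exact: cvg_cst].
  apply: harmonic_onB; first exact: openI.
    exact: harmonic_on_sub (@subIsetl _ _ _) (harmonic_on_segpot c1 r1).
  exact: harmonic_on_sub (@subIsetr _ _ _) (harmonic_on_segpot c2 r2).
split.
  apply: harmonic_on_sub plane_part => z Wz; split=> -[th Ith zE];
    apply: (WK _ Wz); exists z => //; rewrite -zE; [exact: K1|exact: K2].
have oVV : open (V c1 r1 `&` V c2 r2) by exact: openI.
apply: (@harmonic_on_sub _ (V c1 r1 `&` V c2 r2)).
  by move=> z /WK zK; split; exact: chart_in_V.
apply: (@harmonic_on_eq _ _ (chartpot c1 r1 \- chartpot c2 r2)) => //.
  move=> z [V1 V2] /=; rewrite /chart_infty; case: eqP => [->|/eqP z0] /=.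
    have chart0 (c r : R) : chartpot c r 0 = 0.
      rewrite /chartpot [LHS](_ : _ = \int[mu]_(th in I01) cst 0 th); last first.
        apply: eq_Rintegral => th _.
        by rewrite /sqr_affine/= !mulr0 addr0 expr1n expr0n/= addr0 ln1 mulr0.
      by rewrite Rintegral_cst// mul0r.
    by rewrite !chart0 subrr.
  rewrite !segpot_chart//.
  by rewrite opprB addrA subrK.
apply: harmonic_onB; first exact: oVV.
  exact: harmonic_on_sub (@subIsetl _ _ _) (harmonic_on_log_integral (@onec) (@opp_segc c1 r1)).
exact: harmonic_on_sub (@subIsetr _ _ _) (harmonic_on_log_integral (@onec) (@opp_segc c2 r2)).
Qed.

Lemma continuous_segpot_diff : continuous (fun z : plane R => segpot_diff (Some z)).
Proof. by move=> z; apply: cvgB; exact: continuous_segpot. Qed.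

(** On a large square by compactness; outside it both potentials are within ln 4
    of log |z|. *)
Lemma segpot_diff_bounded : exists M : R, forall w, `|segpot_diff w| <= M.
Proof.
pose m (c r : R) := `|c| + `|r|.
have mP (c r th : R) : I01 th -> `|c + th * r| <= m c r.
  rewrite /= in_itv/= => /andP[th0 th1].
  rewrite (le_trans (ler_normD _ _))// lerD2l normrM ger0_norm// ler_piMl//.
pose B := 4 * (m c1 r1 + m c2 r2) + 1.
have m0 c r : 0 <= m c r by rewrite addr_ge0.
have B0 : 0 < B by rewrite ltr_wpDl// mulr_ge0// addr_ge0.
have B1 th : I01 th -> `|c1 + th * r1| <= B / 4.
  by move=> /mP - /(_ c1 r1) h; have := m0 c2 r2; rewrite /B; lra.
have B2 th : I01 th -> `|c2 + th * r2| <= B / 4.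
  by move=> /mP - /(_ c2 r2) h; have := m0 c1 r1; rewrite /B; lra.
have cS : compact (`[- B, B]%classic `*` `[- B, B]%classic : set (plane R)).
  by apply: compact_setX; exact: segment_compact.
have [M [_ HM]] := compact_bounded (continuous_compact
  (continuous_subspaceT continuous_segpot_diff) cS).
exists (Num.max (M + 1) (ln 4 + ln 4)) => -[z|]; last first.
  by rewrite /= normr0 le_max orbC addr_ge0// ln_ge0// ler1n.
rewrite le_max; have [zB|zB] := leP (modulus z) B; apply/orP; [left|right].
  have /HM := ltr_pwDr ltr01 (lexx M); apply.
  exists z => //; have := le_trans (normr_le_modulus z) zB.
  have : `|z.2| <= modulus z by rewrite -sqrtr_sqr ler_wsqrtr// lerDr sqr_ge0.
  by move=> /le_trans/(_ zB); rewrite !ler_norml => h1 h2; split; rewrite /= in_itv/=.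
have h1 := segpot_far r10 B0 B1 (ltW zB); have h2 := segpot_far r20 B0 B2 (ltW zB).
have tri (p q s : R) : p - q = (p - s) - (q - s) by ring.
rewrite [X in `|X|](tri _ _ (ln (modulus z))).
exact: (le_trans (ler_normB _ _) (lerD h1 h2)).
Qed.

Lemma prob_on_neq0 (A : set (plane R)) (P : probability (plane R) R) :
  prob_on A P -> A !=set0.
Proof.
move=> PA; apply/set0P/eqP => A0; move: PA.
by rewrite /prob_on /= A0 setC0 probability_setT => /eqP; rewrite onee_eq0.
Qed.

Lemma capacity_set0 : capacity (@set0 (plane R)) = 0%E.
Proof.
have prob0 : prob_on (@set0 (plane R)) = set0 :> set (probability (plane R) R).
  by rewrite -subset0 => P /prob_on_neq0[].
rewrite /capacity (_ : [set compact_capacity K | K in _] = [set 0%E]) ?ereal_sup1//.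
apply/seteqP; split=> [_ /= [L [_]] + <-|_ ->] /=.
  by rewrite subset0 => ->; rewrite /compact_capacity prob0 image_set0 ereal_inf0.
exists set0; first by split; [exact: compact0|].
by rewrite /compact_capacity prob0 image_set0 ereal_inf0.
Qed.

(** The boundary values are attained at every boundary point, so the exceptional
    set is empty. *)
Lemma segpot_diff_dirichlet (W : set (sphere R)) : W `<=` ~` (Some @` K) ->
  dirichlet_solution W (fun z => segpot_diff (Some z)) segpot_diff.
Proof.
move=> WK; split; first exact: segpot_diff_harmonic.
  by have [M HM] := segpot_diff_bounded; exists M.
rewrite (_ : [set z | _] = set0) ?capacity_set0//.
rewrite -subset0 => z [_]; apply.
by apply: cvg_within_filter; exact: continuous_segpot_diff.
Qed.

End dirichlet_solution_of_segments.

(** * Harmonic measure of the complement of a compact set *)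

Section harmonic_measure_on_compact.
Context {R : realType}.
Implicit Types (z : plane R) (K : set (plane R)).

Lemma connected_ball_plane z (e : R) : connected (ball z e).
Proof.
have [e0|e0] := leP e 0.
  rewrite (_ : ball z e = set0); first exact: connected0.
  by rewrite -subset0 => w [/= h _]; have := le_lt_trans (normr_ge0 _) h; rewrite ltNge e0.
have -> : ball z e = \bigcup_(w in ball z e) [set z + t *: (w - z) | t in `[0%R, 1%R]%classic].
  apply/seteqP; split=> [w zw|_ [w [w1 w2] [t /= + <-]]].
    exists w => //; exists 1; first by rewrite /= in_itv/= ler01 lexx.
    by rewrite scale1r addrC subrK.
  rewrite in_itv/= => /andP[t0 t1].
  have bnd (a b : R) : `|a - b| < e -> `|a - (a + t * (b - a))| < e.
    move=> ab; rewrite opprD addrA subrr sub0r normrN normrM ger0_norm// distrC.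
    by apply: le_lt_trans ab; rewrite ler_piMl.
  by split; exact: bnd.
apply: bigcup_connected.
  exists z => w _; exists 0; first by rewrite /= in_itv/= lexx ler01.
  by rewrite scale0r addr0.
move=> w _; apply: connected_continuous_connected; first exact: segment_connected.
apply: continuous_subspaceT => t; apply: cvgD; first exact: cvg_cst.
exact: scalel_continuous.
Qed.

(** A boundary point off K would have a ball around it that avoids K and meets the
    component; the ball is connected, hence contained in the component, and the
    point would be interior. *)
Lemma boundary_component_subset K (y : sphere R) : closed K ->
  boundary (connected_component (~` (Some @` K) : set (sphere R)) y) `<=` K.
Proof.
set W := connected_component _ _.
move=> cK z [zW zNW]; apply: contrapT => zK.
have : nbhs z (~` K) by apply: open_nbhs_nbhs; split => //; exact: closed_openC.
move=> /nbhs_ballP[e /= e0 zeK].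
have nB : nbhs (Some z : sphere R) (Some @` ball z e).
  by apply: one_point_compactification_some_nbhs; exact: nbhsx_ballx.
have [x [Ww [w zw wE]]] := zW _ nB; rewrite -{x}wE in Ww.
apply: zNW.
have BW : Some @` ball z e `<=` W.
  have Wy : W y by case: Ww => C [Cy CA Cc] _; exists C.
  apply: (@subset_trans _ (W `|` Some @` ball z e)); first exact: subsetUr.
  apply: connected_component_max; first by left.
    move=> x [|[x' zx' <-]]; first exact: connected_component_sub.
    by move=> [x'' Kx'' [xE]]; apply: (zeK _ zx'); rewrite -xE.
  apply: connectedU; first by exists (Some w); split => //; exists w.
    exact: component_connected.
  apply: connected_continuous_connected; first exact: connected_ball_plane.
  exact/continuous_subspaceT/one_point_compactification_some_continuous.
by rewrite /interior; exact: filterS BW nB.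
Qed.

(** The sigma-algebra of the plane is generated by rectangles, so an open set has
    to be written as a countable union of squares, here with rational centers. *)
Lemma open_measurable_plane (U : set (plane R)) : open U -> measurable U.
Proof.
move=> oU.
pose box (p q : rat) (n : nat) : set (plane R) :=
  ball (ratr p : R) n.+1%:R^-1 `*` ball (ratr q : R) n.+1%:R^-1.
have -> : U = \bigcup_p \bigcup_q \bigcup_n
    (if `[< box p q n `<=` U >] then box p q n else set0).
  apply/seteqP; split=> [z Uz|z [p _ [q _ [n _]]]]; last first.
    by case: asboolP => // + zpq; apply.
  have /nbhs_ballP[e /= e0 zeU] := open_nbhs_nbhs (conj oU Uz).
  pose n := Num.truncn (2 / e).
  have n0 : 0 < n.+1%:R^-1 :> R by rewrite invr_gt0.
  have ne : n.+1%:R^-1 + n.+1%:R^-1 <= e.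
    have h : 2 / e < n.+1%:R by exact: Num.Theory.truncnS_gt.
    rewrite -mulr2n -[_ *+ 2]mulr_natl ler_pdivrMr// mulrC -ler_pdivrMr// ltW//.
  have rat_near (x : R) : exists q : rat, `|x - ratr q| < n.+1%:R^-1.
    have [] := @dense_rat R (ball x n.+1%:R^-1).
    - by exists x; exact: ballxx.
    - exact: ball_open.
    - by move=> x' [xq [q _ qE]]; exists q; move: xq; rewrite -qE -ball_normE.
  have [p hp] := rat_near z.1; have [q hq] := rat_near z.2.
  exists p => //; exists q => //; exists n => //.
  rewrite asboolT; last first.
    move=> w [/= w1 w2]; apply: zeU; split.
      apply: (le_ball ne); apply: ball_triangle w1.
      by rewrite -ball_normE /=.
    apply: (le_ball ne); apply: ball_triangle w2.
    by rewrite -ball_normE /=.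
  by split; rewrite -ball_normE /= distrC.
apply: bigcupT_measurable_rat => p; apply: bigcupT_measurable_rat => q.
apply: bigcup_measurable => n _; case: asboolP => // _.
by apply: measurableX; exact: measurable_ball.
Qed.

Lemma closed_measurable_plane (A : set (plane R)) : closed A -> measurable A.
Proof.
by move=> cA; rewrite -[A]setCK; apply: measurableC; apply: open_measurable_plane; exact: closed_openC.
Qed.

Lemma closed_boundary (W : set (sphere R)) : closed (boundary W).
Proof.
apply: (@closed_comp _ _ (Some : plane R -> sphere R) (closure W `\` interior W)).
  by move=> z _; exact: one_point_compactification_some_continuous.
by rewrite setDE; apply: closedI; [exact: closed_closure|apply: open_closedC; exact: open_interior].
Qed.

Lemma continuous_measurable_plane (f : plane R -> R) :
  continuous f -> measurable_fun setT f.
Proof.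
move=> cf; apply: (measurability _ (RGenOpens.measurableE R)) => //.
move=> _ [_ [a [b ->] <-]]; rewrite setTI; apply: open_measurable_plane.
by apply: open_comp => [z _|]; [exact: cf|exact: interval_open].
Qed.

Lemma integral_conull d (T : measurableType d) (mu : {measure set T -> \bar R})
    (D : set T) (f : T -> \bar R) : measurable D -> mu (~` D) = 0%E ->
  measurable_fun setT f ->
  (\int[mu]_(x in D) f x = \int[mu]_x f x)%E.
Proof.
move=> mD D0 mf; rewrite -[in RHS](setUv D) integral_setU//; first last.
- by apply/disj_setPS => x [].
- exact: measurable_funTS.
- exact: measurableC.
rewrite [X in (_ = _ + X)%E]null_set_integral ?adde0//; first exact: measurableC.
exact: measurable_funTS.
Qed.

Variables (K : set (plane R)) (y : plane R) (omega : probability (plane R) R).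
Hypothesis (cK : closed K) (homega : harmonic_measure y K omega).
Local Notation W := (connected_component (~` (Some @` K) : set (sphere R)) (Some y)).

Lemma harmonic_measure_prob_on : prob_on K omega.
Proof.
have [B0 _] := homega.
have mB := closed_measurable_plane (closed_boundary (W := W)).
have mK := closed_measurable_plane cK.
apply/eqP; rewrite -measure_le0 -B0; apply: le_measure; rewrite ?inE; try exact: measurableC.
by apply: subsetC; exact: boundary_component_subset.
Qed.

(** The defining property of harmonic measure, applied to a function that solves
    the Dirichlet problem with its own boundary values. *)
Lemma integral_harmonic_measure_segpot (c1 r1 c2 r2 : R) : r1 != 0 -> r2 != 0 ->
  (forall th, `[0%R, 1%R]%classic th -> K (ofR (c1 + th * r1))) ->
  (forall th, `[0%R, 1%R]%classic th -> K (ofR (c2 + th * r2))) ->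
  (\int[omega]_z (segpot c1 r1 z - segpot c2 r2 z)%:E =
     (segpot c1 r1 y - segpot c2 r2 y)%:E)%E.
Proof.
move=> r10 r20 K1 K2.
have [B0 /(_ (fun z => segpot_diff c1 r1 c2 r2 (Some z)))] := homega.
have sub : W `<=` ~` (Some @` K) by exact: connected_component_sub.
case; first by apply: continuous_subspaceT; exact: continuous_segpot_diff.
move=> _ /(_ _ (segpot_diff_dirichlet r10 r20 K1 K2 sub)) -> /=.
have mB := closed_measurable_plane (closed_boundary (W := W)).
apply/esym/integral_conull => //.
apply/measurable_EFinP; apply: continuous_measurable_plane.
exact: (@continuous_segpot_diff _ c1 r1 c2 r2 r10 r20).
Qed.

End harmonic_measure_on_compact.

(** * Averages of the kernel over shrinking segments *)

Section averaged_kernel.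
Context {R : realType}.
Local Notation mu := (@lebesgue_measure R).
Local Notation I01 := (`[0%R, 1%R]%classic : set R).
Implicit Types (D u r : R).

Definition avgker D u r : \bar R := (\int[mu]_(th in I01) logker D `|u - th * r|%R)%E.

Let measurable_dist u r : measurable_fun setT (fun th : R => `|u - th * r|).
Proof.
apply: measurableT_comp => //; apply: measurable_funB => //.
exact: measurable_funM.
Qed.

Let measurable_kern D u r : measurable_fun I01 (fun th : R => logker D `|u - th * r|).
Proof.
by apply: measurable_funTS; apply: measurableT_comp; [exact: measurable_logker|exact: measurable_dist].
Qed.

Let integral_unit_cst (x : \bar R) : (\int[mu]_(th in I01) x = x)%E.
Proof. by rewrite integral_cst//= lebesgue_measure_itv/= lte01 oppr0 adde0 mule1. Qed.

Lemma logker_le_add D d v : (logker D v <= (Num.max 0 (D - d))%:E + logker d v)%E.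
Proof.
have [v0|v0] := leP v 0; first by rewrite {2}/logker v0 addey ?leey.
rewrite !logker_gt0E// -EFinD lee_fin.
rewrite ge_max; apply/andP; split; first by rewrite addr_ge0// le_max lexx.
have h1 : D - d <= Num.max 0 (D - d) by rewrite le_max lexx orbT.
have h2 : d - ln v <= Num.max 0 (d - ln v) by rewrite le_max lexx orbT.
lra.
Qed.

(** Uniformity in r is the point: this dominates all the averages as r tends to 0.
    If r is large with respect to u, the singular bound gives
    4 * `|u| / `|r| <= 8; otherwise the distances are at least `|u| / 2 and
    ln 2 <= 1. *)
Lemma avgker_le D u r : r != 0 -> (avgker D u r <= logker D `|u|%R + 8%:E)%E.
Proof.
move=> r0; have [->|u0] := eqVneq u 0; first by rewrite normr0 /logker lexx addye ?leey.
have up : 0 < `|u| by rewrite normr_gt0.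
have rp : 0 < `|r| by rewrite normr_gt0.
rewrite (logker_gt0E _ up).
apply: (@le_trans _ _ (\int[mu]_(th in I01)
    ((Num.max 0 (D - ln `|u|))%:E + logker (ln `|u|) `|u - th * r|%R))%E).
  apply: ge0_le_integral => //.
  - by move=> th _; exact: logker_ge0.
  - exact: measurable_kern.
  - by apply: emeasurable_funD => //; exact: measurable_kern.
  - by move=> th _; exact: logker_le_add.
have max0 (th : R) : I01 th -> (0 <= (Num.max 0 (D - ln `|u|))%:E)%E.
  by move=> _; rewrite lee_fin le_max lexx.
have ker0 (th : R) : I01 th -> (0 <= logker (ln `|u|) `|u - th * r|%R)%E.
  by move=> _; exact: logker_ge0.
have mk := measurable_kern (ln `|u|) u r.
rewrite ge0_integralD//.
rewrite integral_unit_cst leeD2l//.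
have [ur|ru] := leP `|u| (2 * `|r|).
  apply: (le_trans (integral_logker_segment_le _ _ r0)).
  by rewrite lnK// lee_fin ler_pdivrMr//; lra.
apply: (@le_trans _ _ (\int[mu]_(th in I01) (cst 8%:E th))%E); last by rewrite integral_unit_cst.
apply: ge0_le_integral => //.
move=> th /=; rewrite in_itv/= => /andP[th0 th1].
have thr : `|th * r| <= `|r| by rewrite normrM ger0_norm// ler_piMl.
have d1 : `|u| / 2 <= `|u - th * r|.
  have := ler_normD (u - th * r) (th * r); rewrite subrK; lra.
apply: (le_trans (logker_le _ d1)).
have u2 : 0 < `|u| / 2 by rewrite divr_gt0.
rewrite logker_gt0E// lee_fin ge_max ler0n/= ln_div ?posrE//.
have : ln 2 <= 1 :> R by apply: (le_trans (le_ln1Dx (x := 1) _)) => //; lra.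
lra.
Qed.

(** For u != 0 the average is a continuous function of r at 0.  For u = 0 it is at
    least the value of the kernel at `|r|, the largest distance. *)
Lemma avgker_cvg D u r : r != 0 ->
  avgker D u (r / n.+1%:R) @[n --> \oo] --> logker D `|u|%R.
Proof.
move=> r0.
have rn0 : r / n.+1%:R @[n --> \oo] --> (0 : R).
  rewrite -(mulr0 r); apply: cvgM; first exact: cvg_cst.
  exact: cvg_harmonic.
have [->|u0] := eqVneq u 0.
  have rn0' : `|r / n.+1%:R| @[n --> \oo] --> (0 : R).
    by rewrite -[X in _ --> X](@normr0 _ R^o); exact: cvg_norm.
  have cvgy : logker D `|r / n.+1%:R| @[n --> \oo] --> +oo%E.
    have -> : +oo%E = logker D 0 by rewrite /logker lexx.
    exact: (cvg_comp _ _ rn0' (@continuous_logker R D 0)).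
  rewrite normr0 [X in _ --> X]/logker lexx.
  apply/cvgeyPge => A; move/cvgeyPge : cvgy => /(_ A); apply: filterS => n /le_trans; apply.
  rewrite -[leLHS]integral_unit_cst; apply: ge0_le_integral => //.
  - by move=> th _; exact: logker_ge0.
  - exact: measurable_kern.
  - move=> th /=; rewrite in_itv/= => /andP[th0 th1]; apply: logker_le.
    by rewrite sub0r normrN normrM ger0_norm// ler_piMl.
have up : 0 < `|u| by rewrite normr_gt0.
pose k (th x : R) := Num.max 0 (D - ln `|u - th * x|).
have dist_gt0 (th x : R) : I01 th -> `|x| < `|u| -> 0 < `|u - th * x|.
  rewrite /= in_itv/= => /andP[th0 th1] xu.
  have thx : `|th * x| <= `|x| by rewrite normrM ger0_norm// ler_piMl.
  by have := ler_normD (u - th * x) (th * x); rewrite subrK; lra.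
have kc (th x : R) : I01 th -> `|x| < `|u| -> {for (th, x), continuous (fun p => k p.1 p.2)}.
  move=> Ith xu.
  have dc : {for (th, x), continuous (fun p : R * R => `|u - p.1 * p.2|)}.
    apply: cvg_norm; apply: cvgB; first exact: cvg_cst.
    by apply: cvgM; [exact: cvg_fst|exact: cvg_snd].
  apply: (@continuous_max R _ (cst 0) (fun p : R * R => D - ln `|u - p.1 * p.2|)).
    exact: cvg_cst.
  apply: cvgB; first exact: cvg_cst.
  apply: (@continuous_comp _ _ _ (fun p : R * R => `|u - p.1 * p.2|) (@ln R)); first exact: dc.
  by apply: continuous_ln; exact: dist_gt0.
have near_u : \forall x \near (0 : R), `|x| < `|u|.
  have := @nbhsx_ballx _ R (0 : R) _ up; apply: filterS => x.
  by rewrite -ball_normE /= sub0r normrN.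
have kE x : `|x| < `|u| -> avgker D u x = (\int[mu]_(th in I01) k th x)%:E.
  move=> xu; rewrite fineK; last first.
    apply: integrable_fin_num => //; apply: (@integrable_slice _ _ k x) => th Ith.
    exact: kc.
  by apply: eq_integral => th /set_mem Ith; rewrite logker_gt0E// dist_gt0.
have k_cvg : (\int[mu]_(th in I01) k th x) @[x --> (0 : R)] --> \int[mu]_(th in I01) k th 0.
  apply: continuous_Rintegral_unit.
  by apply: filterS near_u => x xu th Ith; exact: kc.
have -> : logker D `|u| = (\int[mu]_(th in I01) k th 0)%:E.
  rewrite -kE ?normr0// /avgker; under eq_integral do rewrite mulr0 subr0.
  by rewrite integral_unit_cst.
have seq_cvg := cvg_EFin_comp (cvg_comp _ _ rn0 k_cvg).
apply: (@cvg_trans _ ((\int[mu]_(th in I01) k th (r / n.+1%:R))%:E @[n --> \oo])).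
  apply: near_eq_cvg; near=> n; apply/esym/kE.
  by near: n; exact: (rn0 _ near_u).
exact: seq_cvg.
Unshelve. all: by end_near. Qed.

End averaged_kernel.

Section cvg_nonneg_integral.
Context d (T : measurableType d) (R : realType).
Variable mu : {measure set T -> \bar R}.
Variable A : set T.
Local Open Scope ereal_scope.

(** Dominated convergence when the limit is integrable, Fatou's lemma when its
    integral is +oo. *)
Lemma cvg_integral_le_addr (f_ : nat -> T -> \bar R) (f : T -> \bar R) (C : R) :
  measurable A -> mu A < +oo ->
  (forall n, measurable_fun A (f_ n)) -> measurable_fun A f ->
  (forall n x, A x -> 0 <= f_ n x) -> (forall x, A x -> 0 <= f x) ->
  (forall n x, A x -> f_ n x <= f x + C%:E) ->
  (forall x, A x -> f_ n x @[n --> \oo] --> f x) ->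
  \int[mu]_(x in A) f_ n x @[n --> \oo] --> \int[mu]_(x in A) f x.
Proof.
move=> mA Afin mf_ mf f_0 f0 f_C f_f.
have [foo|] := ltP (\int[mu]_(x in A) f x) +oo.
  have if_ : mu.-integrable A f.
    apply/integrableP; split => //.
    rewrite (eq_integral f)// => x /set_mem Ax; rewrite gee0_abs//; exact: f0.
  have iC : mu.-integrable A (cst C%:E).
    apply/integrableP; split => //.
    by rewrite integral_cst//= lte_mul_pinfty.
  have ig : mu.-integrable A (fun x => f x + C%:E).
    exact: (@integrableD _ _ _ mu _ mA _ _ if_ iC).
  have f_g x n : A x -> `|f_ n x| <= f x + C%:E.
    by move=> Ax; rewrite gee0_abs; [exact: f_C|exact: f_0].
  by have [] := dominated_convergence mA mf_ mf (aeW _ f_f) ig (aeW _ f_g).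
rewrite leye_eq => /eqP foo; rewrite foo.
have := fatou mu mA mf_ f_0.
have -> : \int[mu]_(x in A) limn_einf (f_ ^~ x) = +oo.
  by rewrite -foo; apply: eq_integral => x /set_mem Ax; have [-> _] := cvg_limn_einf_sup (f_f x Ax).
rewrite leye_eq => /eqP; rewrite limn_einf_lim => liminf_oo.
apply/cvgeyPge => B; have := is_cvg_einfs (u := fun n => \int[mu]_(x in A) f_ n x).
rewrite liminf_oo => /cvgeyPge/(_ B); apply: filterS => n /le_trans; apply.
by apply: ereal_inf_lbound; exists n => //=.
Qed.

End cvg_nonneg_integral.

(** * Integration against probabilities and mixtures *)

Section integrals_against_probabilities.
Local Open Scope ereal_scope.
Context {R : realType}.

Lemma eq_integral_conull d (T : measurableType d) (mu : {measure set T -> \bar R})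
    (D : set T) (f g : T -> \bar R) : measurable D -> mu (~` D) = 0 ->
  measurable_fun setT f -> measurable_fun setT g -> (forall x, D x -> f x = g x) ->
  \int[mu]_x f x = \int[mu]_x g x.
Proof.
move=> mD D0 mf mg fg.
rewrite -(integral_conull mD D0 mf) -(integral_conull mD D0 mg).
by apply: eq_integral => x /set_mem /fg.
Qed.

Let negpart_shift_le (T : Type) (f : T -> \bar R) (D : R) : (forall x, 0 <= f x) ->
  forall x : T, [set: T] x -> (fun x => f x - D%:E)^\- x <= `|D|%:E.
Proof.
move=> f0 x _; rewrite funenegE ge_max; apply/andP; split; last by rewrite lee_fin.
case: (f x) (f0 x) => [r| |]//; last by rewrite leNye.
by rewrite !lee_fin /= => r0; rewrite opprB; have := ler_norm D; lra.
Qed.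

(** When the integral of f is +oo, the negative part of f - D still has integral at
    most `|D|, and both sides are +oo. *)
Lemma integralB_cst d (T : measurableType d) (mu : {measure set T -> \bar R})
    (f : T -> \bar R) (D : R) : mu setT = 1 ->
  measurable_fun setT f -> (forall x, 0 <= f x) ->
  \int[mu]_x (f x - D%:E) = \int[mu]_x f x - D%:E.
Proof.
move=> mu1 mf f0.
have icst (C : R) : \int[mu]_x C%:E = C%:E by rewrite integral_cst//= mu1 mule1.
have iC (C : R) : mu.-integrable setT (cst C%:E).
  by apply/integrableP; split => //; rewrite (eq_integral (cst `|C|%R%:E))// icst ltry.
have [foo|] := ltP (\int[mu]_x f x) +oo.
  have if_ : mu.-integrable setT f.
    apply/integrableP; split => //.
    by rewrite (eq_integral f)// => x _; rewrite gee0_abs.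
  by rewrite -[in RHS](icst D); exact: (@integralB _ _ _ mu setT measurableT f (cst D%:E) if_ (iC D)).
rewrite leye_eq => /eqP foo; rewrite foo addye//.
have mfD : measurable_fun setT (fun x => f x - D%:E) by exact: emeasurable_funB.
set g := fun x => f x - D%:E.
have gn : \int[mu]_x g^\- x <= `|D|%:E.
  rewrite -(icst `|D|%R); apply: ge0_le_integral => //.
    exact: measurable_funeneg.
  exact: negpart_shift_le.
have gp : \int[mu]_x g^\+ x = +oo.
  apply/eqP; rewrite -leye_eq -(@leeD2rE _ `|D|%:E)// addye// -foo -(icst `|D|%R).
  rewrite -ge0_integralD//; last by exact: measurable_funepos.
  apply: ge0_le_integral => //.
    by apply: emeasurable_funD => //; exact: measurable_funepos.
  move=> x _; rewrite /g funeposE; case: (f x) (f0 x) => [r| |]//.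
  rewrite lee_fin => r0; rewrite -EFinB -EFin_max -EFinD lee_fin.
  have : (r - D <= Num.max (r - D) 0)%R by rewrite le_max lexx.
  by have := ler_norm D; lra.
have gfin : \int[mu]_x g^\- x \is a fin_num.
  by rewrite ge0_fin_numE ?integral_ge0//; exact: le_lt_trans gn (ltry _).
by rewrite integralE gp -(fineK gfin).
Qed.

Lemma integral_cstB d (T : measurableType d) (mu : {measure set T -> \bar R})
    (f : T -> \bar R) (D : R) : mu setT = 1 ->
  measurable_fun setT f -> (forall x, 0 <= f x) ->
  \int[mu]_x (D%:E - f x) = D%:E - \int[mu]_x f x.
Proof.
move=> mu1 mf f0.
have E : (fun x => D%:E - f x) = (fun x => - (f x - D%:E)).
  by apply/funext => x; rewrite fin_num_oppeB// addeC.
have finD : \int[mu]_x (cst `|D|%R%:E) x = `|D|%:E by rewrite integral_cst//= mu1 mule1.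
have gn : \int[mu]_x (fun x => f x - D%:E)^\- x <= `|D|%:E.
  rewrite -finD; apply: ge0_le_integral => //.
    by apply: measurable_funeneg; exact: emeasurable_funB.
  exact: negpart_shift_le.
rewrite E integralN; last first.
  by apply: fin_num_adde_defl; rewrite fin_numN ge0_fin_numE ?integral_ge0//; exact: le_lt_trans gn (ltry _).
by rewrite integralB_cst// fin_num_oppeB// addeC.
Qed.

End integrals_against_probabilities.

Section mixture_integral.
Context {R : realType} {n : nat}.
Variables (t : 'I_n.+1 -> {nonneg R}).
Variables (nu : probability (plane R) R) (omega : 'I_n -> probability (plane R) R).
Local Open Scope ereal_scope.

Lemma ge0_integral_mixture (f : plane R -> \bar R) :
  measurable_fun setT f -> (forall z, 0 <= f z) ->
  \int[mixture t nu omega]_z f z = (t ord0)%:num%:E * \int[nu]_z f z +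
    \sum_(i < n) (t (lift ord0 i))%:num%:E * \int[omega i]_z f z.
Proof.
move=> mf f0.
pose w (k : nat) : {measure set (plane R) -> \bar R} :=
  if insub k is Some i then mscale (t (lift ord0 i)) (omega i) else mzero.
rewrite (@eq_measure_integral _ _ _ _ (measure_add (mscale (t ord0) nu) (msum w n))); last first.
  move=> A mA _; apply: etrans (esym (measure_addE _ _ _)).
  rewrite /= /mscale /msum /=; congr (_ + _).
  by apply: eq_bigr => i _; rewrite /w valK.
rewrite ge0_integral_measure_add// ge0_integral_mscale// ge0_integral_measure_sum//.
by congr (_ + _); apply: eq_bigr => i _; rewrite /w valK ge0_integral_mscale.
Qed.

Lemma mixture_setT : (\sum_i (t i)%:num = 1)%R -> mixture t nu omega setT = 1.
Proof.
move=> t1; rewrite /mixture probability_setT mule1.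
under eq_bigr do rewrite probability_setT mule1.
by rewrite sumEFin -EFinD -t1 big_ord_recl.
Qed.

Lemma mixture_null (A : set (plane R)) : nu A = 0 -> (forall i, omega i A = 0) ->
  mixture t nu omega A = 0.
Proof. by move=> n0 o0; rewrite /mixture n0 mule0 add0e big1// => i _; rewrite o0 mule0. Qed.

End mixture_integral.

(** * Potentials and mutual energies *)

Section segment_probability.
Context {R : realType}.
Local Notation mu := (@lebesgue_measure R).
Local Notation I01 := (`[0%R, 1%R]%classic : set R).
Variables c r : R.

(* The uniform distribution is a measure on the copy [measurableTypeR R] of R,
   whose sigma-algebra is the Borel one. *)
Let param (th : measurableTypeR R) : plane R := ofR (c + th * r).

Let measurable_param : measurable_fun setT param.
Proof.
apply: measurable_fun_pair => /=; last exact: measurable_cst.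
by apply: measurable_funD => //; exact: measurable_funM.
Qed.

Let param_mixin := isMeasurableFun.Build _ _ _ _ _ measurable_param.
Let param_mfun : {mfun _ >-> _} := HB.pack param param_mixin.

Definition segment_prob : probability (plane R) R :=
  distribution (uniform_prob (@ltr01 R)) param_mfun.

Lemma integral_segment_prob (f : plane R -> \bar R) :
  measurable_fun setT f -> (forall z, (0 <= f z)%E) ->
  (\int[segment_prob]_z f z = \int[mu]_(th in I01) f (ofR (c + th * r)))%E.
Proof.
move=> mf f0; rewrite ge0_integral_distribution// integral_uniform.
- by rewrite subr0 invr1 mul1e.
- exact: measurableT_comp.
- by move=> x; exact: f0.
Qed.

Lemma segment_prob_on (K : set (plane R)) : measurable K ->
  (forall th, I01 th -> K (ofR (c + th * r))) -> prob_on K segment_prob.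
Proof.
move=> mK Kc; rewrite /prob_on /=.
have mKC : measurable (~` K) by exact: measurableC.
have mind : measurable_fun setT (EFin \o (\1_(~` K) : plane R -> R)).
  by apply/measurable_EFinP; exact: measurable_indic.
have ind0 z : (0 <= (EFin \o (\1_(~` K) : plane R -> R)) z)%E by rewrite lee_fin.
have := integral_segment_prob mind ind0.
rewrite integral_indic// setIT => segE; apply: (etrans segE).
rewrite (eq_integral (cst 0%E)) ?integral0// => th /set_mem Ith.
by rewrite /= indicE memNset//= => /(_ (Kc _ Ith)).
Qed.

End segment_probability.

Section energies.
Context {R : realType}.
Implicit Types (D : R) (z w : plane R) (P Q : probability (plane R) R).

Definition pker D z w := logker D (modulus (z - w)).

Lemma pker_ge0 D z w : (0 <= pker D z w)%E. Proof. exact: logker_ge0. Qed.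

Lemma pkerC D z w : pker D z w = pker D w z.
Proof.
by rewrite /pker /modulus -(sqrrN (z - w).1) -(sqrrN (z - w).2) /= !opprB.
Qed.

Lemma measurable_pker D : measurable_fun setT (fun p : plane R * plane R => pker D p.1 p.2).
Proof.
apply: measurableT_comp; first exact: measurable_logker.
apply: measurableT_comp; first exact: measurable_modulus.
apply: measurable_fun_pair => /=.
  by apply: measurable_funB; apply: measurableT_comp.
by apply: measurable_funB; apply: measurableT_comp.
Qed.

Lemma measurable_pker_r D z : measurable_fun setT (pker D z).
Proof. exact: measurableT_comp (measurable_pker D) (measurable_pair1 z). Qed.

Lemma log_abs_pker D z w : ln (modulus (z - w)) <= D ->
  log_abs (toC (z - w)) = (D%:E - pker D z w)%E.
Proof.
move=> zD; rewrite log_absE /pker /logker /lne; case: ifPn => // m0.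
rewrite (_ : Num.max _ _ = D - ln (modulus (z - w))).
  by rewrite -EFinB subKr.
by apply/max_idPr; rewrite subr_ge0.
Qed.

Lemma measurable_lne : measurable_fun setT (fun v : R => lne v%:E).
Proof.
apply: measurable_fun_ifT => //=; first exact: measurable_fun_ler.
by apply/measurable_EFinP; exact: measurable_ln.
Qed.

Lemma measurable_log_abs :
  measurable_fun setT (fun p : plane R * plane R => log_abs (toC (p.1 - p.2))).
Proof.
apply: (@measurableT_comp _ _ _ _ _ _ (fun v : R => lne v%:E) _ (fun p : plane R * plane R => modulus (p.1 - p.2))).
  exact: measurable_lne.
apply: measurableT_comp; first exact: measurable_modulus.
apply: measurable_fun_pair => /=.
  by apply: measurable_funB; apply: measurableT_comp.
by apply: measurable_funB; apply: measurableT_comp.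
Qed.

Local Open Scope ereal_scope.

Definition pot D (mu : {measure set (plane R) -> \bar R}) z := \int[mu]_w pker D z w.

Definition mutual_energy D P Q := \int[P]_z pot D Q z.

Lemma measurable_pot D Q : measurable_fun setT (pot D Q).
Proof.
pose f (p : plane R * plane R) := pker D p.1 p.2.
have f0 p : 0 <= f p by exact: pker_ge0.
exact: (@measurable_fun_fubini_tonelli_F _ _ _ _ _ Q f (measurable_pker D) f0).
Qed.

Lemma pot_ge0 D (mu : {measure set (plane R) -> \bar R}) z : 0 <= pot D mu z.
Proof. by apply: integral_ge0 => w _; exact: pker_ge0. Qed.

Lemma mutual_energyC D P Q : mutual_energy D P Q = mutual_energy D Q P.
Proof.
pose f (p : plane R * plane R) := pker D p.1 p.2.
have f0 p : 0 <= f p by exact: pker_ge0.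
rewrite /mutual_energy /pot [LHS](@fubini_tonelli _ _ _ _ _ P Q f (measurable_pker D) f0).
by apply: eq_integral => z _; apply: eq_integral => w _; exact: pkerC.
Qed.

(** Links the energy to the truncated kernel, for which both integrals are of
    nonnegative functions. *)
Lemma energyE (K : set (plane R)) D P : measurable K ->
  (forall z w, K z -> K w -> (ln (modulus (z - w)) <= D)%R) ->
  prob_on K P -> energy P = mutual_energy D P P - D%:E.
Proof.
move=> mK KD P0.
have mlog z : measurable_fun setT (fun w => - log_abs (toC (z - w)%R)).
  by apply: measurableT_comp => //; exact: measurableT_comp measurable_log_abs (measurable_pair1 z).
have inner z : K z -> \int[P]_w (- log_abs (toC (z - w)%R)) = \int[P]_w pker D z w - D%:E.
  move=> Kz; rewrite -integralB_cst//; last 3 first.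
  - exact: probability_setT.
  - exact: measurable_pker_r.
  - by move=> w; exact: pker_ge0.
  apply: (eq_integral_conull mK P0) => //.
    by apply: emeasurable_funB => //; exact: measurable_pker_r.
  by move=> w Kw; rewrite (log_abs_pker (KD _ _ Kz Kw)) oppeB ?fin_num_adde_defr// addeC.
rewrite /energy /mutual_energy /pot -integralB_cst//; last 3 first.
- exact: probability_setT.
- exact: measurable_pot.
- by move=> z; exact: pot_ge0.
apply: (eq_integral_conull mK P0) => //.
- have mlogT : measurable_fun setT (fun p : plane R * plane R => - log_abs (toC (p.1 - p.2)%R)).
    by apply: measurableT_comp => //; exact: measurable_log_abs.
  pose F := fun p : plane R * plane R => - log_abs (toC (p.1 - p.2)%R).
  rewrite (_ : (fun z => _) = (fun z => \int[P]_w (F^\+ (z, w)) - \int[P]_w (F^\- (z, w)))); last first.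
    apply/funext => z; rewrite integralE; congr (_ - _); apply: eq_integral => w _.
      by rewrite !funeposE.
    by rewrite !funenegE.
  apply: emeasurable_funB.
    have mF := measurable_funepos mlogT.
    have F0 p : 0 <= F^\+ p by exact: funepos_ge0.
    exact: (@measurable_fun_fubini_tonelli_F _ _ _ _ _ P F^\+ mF F0).
  have mF := measurable_funeneg mlogT.
  have F0 p : 0 <= F^\- p by exact: funeneg_ge0.
  exact: (@measurable_fun_fubini_tonelli_F _ _ _ _ _ P F^\- mF F0).
- by apply: emeasurable_funB => //; exact: measurable_pot.
Qed.

End energies.

(** * Maximum principle for measures on the real line *)

Section maximum_principle.
Context {R : realType}.
Implicit Types (D : R) (z w : plane R) (S : set R).
Local Notation mu_type := {measure set (plane R) -> \bar R}.

Lemma modulus_ofR (x y : R) : modulus (ofR x - ofR y) = `|x - y|.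
Proof. by rewrite /modulus /= oppr0 addr0 expr0n /= addr0 sqrtr_sqr. Qed.

(** The maximum of 0 and of the convex function D - ln; at a vanishing argument
    the right-hand side is +oo. *)
Lemma logker_convex D (a b th : R) : 0 <= a -> 0 <= b -> 0 < th -> th < 1 ->
  (logker D ((1 - th) * a + th * b)%R <=
   (1 - th)%:E * logker D a + th%:E * logker D b)%E.
Proof.
move=> a0 b0 th0 th1; have th1' : 0 < 1 - th by rewrite subr_gt0.
have nNy (c v : R) : 0 < c -> (c%:E * logker D v != -oo)%E.
  move=> c0; apply/eqP => h; have := mule_ge0 (ltW c0 : (0 <= c%:E)%E) (logker_ge0 D v).
  by rewrite h.
have [a00|ap] := leP a 0.
  by rewrite [X in (_ * X + _)%E]/logker a00 gt0_muley ?lte_fin// addye ?leey// nNy//.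
have [b00|bp] := leP b 0.
  by rewrite [X in (_ + _ * X)%E]/logker b00 gt0_muley ?lte_fin// addey ?leey// nNy//.
have abp : 0 < (1 - th) * a + th * b by rewrite addr_gt0// mulr_gt0.
rewrite !logker_gt0E// -!EFinM -EFinD lee_fin.
have lnc : (1 - th) * ln a + th * ln b <= ln ((1 - th) * a + th * b).
  have th1le : 1 - th <= 1 by rewrite gerBl ltW.
  have := @concave_ln R (Itv01 (ltW th1') th1le) a b ap bp.
  by rewrite !convRE /= /unstable.onem subKr.
rewrite ge_max; apply/andP; split.
  by rewrite addr_ge0// mulr_ge0 ?le_max ?lexx// ltW.
have h1 : D - ln a <= Num.max 0 (D - ln a) by rewrite le_max lexx orbT.
have h2 : D - ln b <= Num.max 0 (D - ln b) by rewrite le_max lexx orbT.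
have := lerD (ler_wpM2l (ltW th1') h1) (ler_wpM2l (ltW th0) h2).
lra.
Qed.

Lemma closed_ofR_image S : closed S -> closed (ofR @` S : set (plane R)).
Proof.
move=> cS.
rewrite (_ : ofR @` S = (fst : plane R -> R) @^-1` S `&` (snd : plane R -> R) @^-1` [set 0]).
  apply: closedI; apply: closed_comp.
  - by move=> z _; exact: cvg_fst.
  - exact: cS.
  - by move=> z _; exact: cvg_snd.
  - exact: closed_eq.
by apply/seteqP; split=> [_ [x Sx <-]//|[x v] [/= Sx ->]]; exists x.
Qed.

Lemma measurable_ofR_image S : closed S -> measurable (ofR @` S).
Proof. by move=> cS; apply: closed_measurable_plane; exact: closed_ofR_image. Qed.

Lemma le_integral_conull (mu : mu_type) (A : set (plane R)) (f g : plane R -> \bar R) :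
  measurable A -> mu (~` A) = 0%E -> measurable_fun setT f -> measurable_fun setT g ->
  (forall z, 0 <= f z)%E -> (forall z, A z -> (f z <= g z)%E) ->
  (\int[mu]_z f z <= \int[mu]_z g z)%E.
Proof.
move=> mA A0 mf mg f0 fg; rewrite -(integral_conull mA A0 mf) -(integral_conull mA A0 mg).
by apply: ge0_le_integral => //; exact: measurable_funTS.
Qed.

Lemma closed_has_max S : closed S -> has_sup S -> S (sup S).
Proof. by move=> cS [S0 Sub]; apply: cS; exact: closure_sup. Qed.

Lemma closed_has_min S : closed S -> has_inf S -> S (inf S).
Proof.
move=> cS iS; apply: cS => U /nbhs_ballP[e /= e0 eU].
have [s Ss se] := inf_adherent e0 iS.
exists s; split => //; apply: eU; rewrite -ball_normE /= distrC ger0_norm ?ltrBlDl//.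
by rewrite subr_ge0; apply: ge_inf => //; exact: iS.2.
Qed.

(** A real point outside S lies between two points of S that are adjacent in S, or
    beyond all of S.  In the first case, seen from any point of S, the distances
    to the three points are in the same affine relation as the points themselves,
    and the kernel is convex in the distance.  In the second case the extreme
    point of S is closer to all of S. *)
Lemma pot_max_principle (mu : mu_type) S D (C : \bar R) :
  closed S -> bounded_set S -> S !=set0 -> mu (~` (ofR @` S)) = 0%E ->
  (forall s, S s -> (pot D mu (ofR s) <= C)%E) ->
  forall x, (pot D mu (ofR x) <= C)%E.
Proof.
move=> cS bS S0 mu0 SC x.
have mS : measurable (ofR @` S) by exact: measurable_ofR_image.
have mono (y : R) : (forall s, S s -> `|y - s| <= `|x - s|) -> S y -> (pot D mu (ofR x) <= C)%E.
  move=> h Sy; apply: le_trans (SC _ Sy).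
  apply: (le_integral_conull mS mu0); try exact: measurable_pker_r.
    by move=> w; exact: pker_ge0.
  by move=> _ [s Ss <-]; rewrite /pker !modulus_ofR; apply: logker_le; exact: h.
have [Sx|Sx] := pselect (S x); first exact: SC.
have [M [_ /(_ (M + 1)) HM]] := bS.
have {}HM s : S s -> `|s| <= M + 1 by apply: HM; rewrite ltrDl.
pose A := S `&` `]-oo, x]; pose B := S `&` `[x, +oo[.
have maxA : A !=set0 -> A (sup A).
  move=> A0; apply: closed_has_max; first by apply: closedI => //; exact: interval_closed.
  split => //; exists x => s [_] /=; rewrite in_itv/=; exact.
have minB : B !=set0 -> B (inf B).
  move=> B0; apply: closed_has_min; first by apply: closedI => //; exact: interval_closed.
  split => //; exists x => s [_] /=; rewrite in_itv/= andbT; exact.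
have leA s : A s -> s <= sup A.
  move=> As; apply: ub_le_sup => //; exists x => s' [_] /=; rewrite in_itv/=; exact.
have geB s : B s -> inf B <= s.
  move=> Bs; apply: ge_inf => //; exists x => s' [_] /=; rewrite in_itv/= andbT; exact.
have sAB s : S s -> A s \/ B s.
  by move=> Ss; have [sx|xs] := leP s x; [left|right]; split; rewrite //= in_itv/= ?andbT// ltW.
have [A0|/set0P/negP/negPn/eqP A0] := pselect (A !=set0); last first.
  have [s Ss] := S0; have B0 : B !=set0.
    by exists s; have [|//] := sAB _ Ss; rewrite A0.
  have [Sb] := minB B0; rewrite /= in_itv/= andbT => xb.
  apply: (mono (inf B)) => // s' Ss'; have [|Bs'] := sAB _ Ss'; first by rewrite A0.
  have := geB _ Bs' => h; rewrite ler0_norm ?subr_le0// ler0_norm ?subr_le0 ?(le_trans xb)//.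
  by rewrite lerN2 lerD2r.
have [Sa] := maxA A0; rewrite /= in_itv/= => ax.
have [B0|/set0P/negP/negPn/eqP B0] := pselect (B !=set0); last first.
  apply: (mono (sup A)) => // s' Ss'; have [As'|] := sAB _ Ss'; last by rewrite B0.
  have := leA _ As' => h; rewrite ger0_norm ?subr_ge0// ger0_norm ?subr_ge0 ?(le_trans h)//.
  by rewrite lerD2r.
have [Sb] := minB B0; rewrite /= in_itv/= andbT => xb.
move: leA geB Sa Sb ax xb; move: (sup A) (inf B) => al be leA geB Sa Sb ax xb.
have {}ax : al < x by rewrite lt_neqAle ax andbT; apply/eqP => E; apply: Sx; rewrite -E.
have {}xb : x < be by rewrite lt_neqAle xb andbT; apply/eqP => E; apply: Sx; rewrite E.
pose th := (x - al) / (be - al).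
have ba : 0 < be - al by rewrite subr_gt0 (lt_trans ax).
have th0 : 0 < th by rewrite divr_gt0// subr_gt0.
have th1 : th < 1 by rewrite ltr_pdivrMr// mul1r ltrD2r.
have xE : x = (1 - th) * al + th * be by rewrite /th; field; rewrite gt_eqF.
have th1' : 0 <= 1 - th by rewrite subr_ge0 ltW.
have mp z : measurable_fun setT (pker D z) by exact: measurable_pker_r.
apply: (@le_trans _ _ (\int[mu]_w ((1 - th)%:E * pker D (ofR al) w + th%:E * pker D (ofR be) w))%E).
  apply: (le_integral_conull mS mu0) => //.
  - by apply: emeasurable_funD; apply: measurable_funeM; exact: mp.
  - by move=> w; exact: pker_ge0.
  - move=> _ [s Ss <-]; rewrite /pker !modulus_ofR.
    have -> : `|x - s| = (1 - th) * `|al - s| + th * `|be - s|.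
      have [As|Bs] := sAB _ Ss.
        have sa := leA _ As.
        have [h1 h2 h3] : [/\ 0 <= x - s, 0 <= al - s & 0 <= be - s] by split; lra.
        by rewrite !ger0_norm// {1}xE; ring.
      have bs := geB _ Bs.
      have [h1 h2 h3] : [/\ x - s <= 0, al - s <= 0 & be - s <= 0] by split; lra.
      by rewrite !ler0_norm// {1}xE; ring.
    exact: logker_convex.
have nn (c : R) y : 0 <= c -> forall w, [set: plane R] w -> (0 <= c%:E * pker D (ofR y) w)%E.
  by move=> c0 w _; rewrite mule_ge0 ?lee_fin//; exact: pker_ge0.
have mm (c : R) y : measurable_fun setT (fun w => c%:E * pker D (ofR y) w)%E.
  by apply: measurable_funeM; exact: mp.
have kge0 y : forall w, [set: plane R] w -> (0 <= pker D (ofR y) w)%E.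
  by move=> w _; exact: pker_ge0.
rewrite (ge0_integralD _ _ (nn _ al th1') (mm _ al) (nn _ be (ltW th0)) (mm _ be))//.
rewrite (ge0_integralZl_EFin _ _ (kge0 al) (mp _) th1')//.
rewrite (ge0_integralZl_EFin _ _ (kge0 be) (mp _) (ltW th0))//.
apply: (@le_trans _ _ ((1 - th)%:E * C + th%:E * C)%E).
  by apply: leeD; apply: lee_wpmul2l; rewrite ?lee_fin ?(ltW th0)//; exact: SC.
have C0 : (0 <= C)%E.
  by apply: le_trans (SC _ Sa); apply: integral_ge0 => w _; exact: pker_ge0.
by rewrite -ge0_muleDl ?lee_fin ?(ltW th0)// -EFinD subrK mul1e.
Qed.

End maximum_principle.

(** * Energies of segments and of convex combinations *)

Section segment_averages.
Context {R : realType}.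
Implicit Types (D : R) (P : probability (plane R) R) (K : set R).
Local Notation I01 := (`[0%R, 1%R]%classic : set R).

Lemma divS_neq0 (r : R) n : r != 0 -> r / n.+1%:R != 0.
Proof. by move=> r0; rewrite mulf_neq0// invr_neq0// pnatr_eq0. Qed.

Lemma subsegment (A : set R) (x r : R) n :
  (forall th, I01 th -> A (x + th * r)) ->
  forall th, I01 th -> A (x + th * (r / n.+1%:R)).
Proof.
move=> seg th /=; rewrite in_itv/= => /andP[th0 th1].
rewrite (_ : th * (r / n.+1%:R) = (th / n.+1%:R) * r); last by ring.
apply: seg; rewrite /= in_itv/= divr_ge0//= ler_pdivrMr// mul1r.
by rewrite (le_trans th1)// ler1n.
Qed.

Lemma pot_segment_prob D (c r : R) z :
  pot D (segment_prob c r) z =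
  (\int[@lebesgue_measure R]_(th in I01) logker D (modulus (z - ofR (c + th * r))%R))%E.
Proof.
rewrite /pot integral_segment_prob//; first exact: measurable_pker_r.
by move=> w; exact: pker_ge0.
Qed.

Lemma pot_segment_prob_ofR D (c r s : R) :
  pot D (segment_prob c r) (ofR s) = avgker D (s - c) r.
Proof.
rewrite pot_segment_prob /avgker; apply: eq_integral => th _.
by rewrite modulus_ofR opprD addrA.
Qed.

Lemma mutual_energy_segment_le D P (c r : R) : r != 0 ->
  (mutual_energy D P (segment_prob c r) <= (4 * expR D / `|r|)%:E)%E.
Proof.
move=> r0; apply: (@le_trans _ _ (\int[P]_z (4 * expR D / `|r|)%:E)%E).
  apply: ge0_le_integral => //.
  - by move=> z _; exact: pot_ge0.
  - exact: measurable_pot.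
  - by move=> z _; rewrite pot_segment_prob; exact: integral_logker_dist_le.
by rewrite integral_cst//= probability_setT mule1.
Qed.

(** The potential at x is the limit of its averages over segments that shrink to
    x, by the bound [avgker_le] uniform in the length of the segment.  The segments
    lie on one side of x, so that x may be an end point of an interval of K. *)
Lemma mutual_energy_segment_cvg D P K (x r : R) : closed K -> prob_on (ofR @` K) P ->
  r != 0 ->
  mutual_energy D P (segment_prob x (r / n.+1%:R)) @[n --> \oo] --> pot D P (ofR x).
Proof.
move=> cK P0 r0; have mK' := measurable_ofR_image cK.
have rn0 n := divS_neq0 n r0.
rewrite /pot -(integral_conull mK' P0); last exact: measurable_pker_r.
have -> : (fun n => mutual_energy D P (segment_prob x (r / n.+1%:R))) =
    (fun n => \int[P]_(z in ofR @` K) pot D (segment_prob x (r / n.+1%:R)) z)%E.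
  by apply/funext => n; rewrite (integral_conull mK' P0)//; exact: measurable_pot.
apply: (@cvg_integral_le_addr _ _ _ P _ _ _ 8) => //.
- by apply: (le_lt_trans (probability_le1 _ mK')); rewrite ltry.
- by move=> n; apply: measurable_funTS; exact: measurable_pot.
- by apply: measurable_funTS; exact: measurable_pker_r.
- by move=> n z _; exact: pot_ge0.
- by move=> z _; exact: pker_ge0.
- move=> n _ [s Ks <-]; rewrite pot_segment_prob_ofR pkerC /pker modulus_ofR.
  exact: avgker_le.
- move=> _ [s Ks <-]; rewrite pkerC /pker modulus_ofR.
  have -> : (fun n => pot D (segment_prob x (r / n.+1%:R)) (ofR s)) =
      (fun n => avgker D (s - x) (r / n.+1%:R)).
    by apply/funext => n; rewrite pot_segment_prob_ofR.
  exact: (@avgker_cvg _ D (s - x) r r0).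
Qed.

End segment_averages.

Section segment_mixture.
Context {R : realType}.
Variables (P Q : probability (plane R) R) (t : R).
Hypotheses (t0 : 0 <= t) (t1 : 0 <= 1 - t).

Let weights (i : 'I_2) : {nonneg R} := if i == ord0 then NngNum t1 else NngNum t0.

Let sum_weights : \sum_i (weights i)%:num = 1.
Proof. by rewrite big_ord_recl big_ord1 /weights /= subrK. Qed.

Definition convex_prob : set (plane R) -> \bar R := mixture weights P (fun=> Q).

HB.instance Definition _ := Measure.on convex_prob.

Let convex_prob_setT : convex_prob setT = 1%E.
Proof. exact: mixture_setT sum_weights. Qed.

HB.instance Definition _ := Measure_isProbability.Build _ _ _ convex_prob convex_prob_setT.

Lemma integral_convex_prob (f : plane R -> \bar R) :
  measurable_fun setT f -> (forall z, 0 <= f z)%E ->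
  (\int[convex_prob]_z f z = (1 - t)%:E * \int[P]_z f z + t%:E * \int[Q]_z f z)%E.
Proof.
move=> mf f0; rewrite [LHS](ge0_integral_mixture weights P (fun=> Q) mf f0).
by rewrite big_ord1.
Qed.

Lemma convex_prob_on (K : set (plane R)) :
  prob_on K P -> prob_on K Q -> prob_on K convex_prob.
Proof. by move=> P0 Q0; rewrite /prob_on /=; apply: mixture_null. Qed.

Lemma mutual_energy_convex_prob D : (mutual_energy D convex_prob convex_prob =
  (1 - t)%:E * ((1 - t)%:E * mutual_energy D P P + t%:E * mutual_energy D P Q) +
  t%:E * ((1 - t)%:E * mutual_energy D Q P + t%:E * mutual_energy D Q Q))%E.
Proof.
have inner z : (pot D convex_prob z = (1 - t)%:E * pot D P z + t%:E * pot D Q z)%E.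
  by apply: integral_convex_prob; [exact: measurable_pker_r|move=> w; exact: pker_ge0].
rewrite /mutual_energy; under eq_integral do rewrite inner.
have mz (A : probability (plane R) R) (a : R) : measurable_fun setT (fun z => a%:E * pot D A z)%E.
  by apply: measurable_funeM; exact: measurable_pot.
have nn (A : probability (plane R) R) (a : R) z : 0 <= a -> (0 <= a%:E * pot D A z)%E.
  by move=> a0; rewrite mule_ge0 ?lee_fin//; exact: pot_ge0.
have outer (A : probability (plane R) R) :
    (\int[A]_z ((1 - t)%:E * pot D P z + t%:E * pot D Q z) =
     (1 - t)%:E * mutual_energy D A P + t%:E * mutual_energy D A Q)%E.
  rewrite (ge0_integralD _ _ (fun z _ => nn P _ z t1) (mz P _) (fun z _ => nn Q _ z t0) (mz Q _))//.
  rewrite (ge0_integralZl_EFin _ _ (fun z _ => pot_ge0 D P z) (measurable_pot D P) t1)//.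
  by rewrite (ge0_integralZl_EFin _ _ (fun z _ => pot_ge0 D Q z) (measurable_pot D Q) t0).
rewrite integral_convex_prob//.
- by rewrite !outer.
- by apply: emeasurable_funD; exact: mz.
- by move=> z; rewrite adde_ge0// nn.
Qed.

End segment_mixture.

(** * The potential of the equilibrium measure *)

Section equilibrium.
Context {R : realType}.
Local Notation I01 := (`[0%R, 1%R]%classic : set R).
Variables (K : set R) (D : R) (nu : probability (plane R) R).
Hypotheses (cK : compact K).
Hypothesis KD : forall x y, K x -> K y -> ln `|x - y| <= D.
Hypothesis segK : forall x, K x -> exists2 r : R, r != 0 &
  forall th, I01 th -> K (x + th * r).
Hypothesis hnu : equilibrium_measure (ofR @` K) nu.

Let closedK : closed K. Proof. exact: compact_closed. Qed.
Let mK' : measurable (ofR @` K). Proof. exact: measurable_ofR_image. Qed.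
Let nu0 : prob_on (ofR @` K) nu. Proof. by case: hnu. Qed.

Let mutual_min (P : probability (plane R) R) : prob_on (ofR @` K) P ->
  (mutual_energy D nu nu <= mutual_energy D P P)%E.
Proof.
move=> P0; have [_ /(_ P P0)] := hnu.
have KD' z w : (ofR @` K) z -> (ofR @` K) w -> ln (modulus (z - w)) <= D.
  by move=> [x Kx <-] [y Ky <-]; rewrite modulus_ofR; exact: KD.
by rewrite (energyE mK' KD' nu0) (energyE mK' KD' P0) leeD2rE.
Qed.

Let seg_on (x r : R) : (forall th, I01 th -> K (x + th * r)) ->
  prob_on (ofR @` K) (segment_prob x r).
Proof. by move=> h; apply: segment_prob_on => // th Ith; exists (x + th * r) => //; exact: h. Qed.

Let K_neq0 : K !=set0.
Proof. by have [_ [x Kx _]] := prob_on_neq0 nu0; exists x. Qed.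

Let E := fine (mutual_energy D nu nu).

Let mutual_ge0 (P Q : probability (plane R) R) : (0 <= mutual_energy D P Q)%E.
Proof. by apply: integral_ge0 => z _; exact: pot_ge0. Qed.

Let mutual_nu : mutual_energy D nu nu = E%:E.
Proof.
have [x Kx] := K_neq0; have [r r0 seg] := segK Kx.
rewrite fineK// ge0_fin_numE//.
apply: le_lt_trans (mutual_min (seg_on seg)) _.
exact: le_lt_trans (mutual_energy_segment_le _ _ _ r0) (ltry _).
Qed.

(* First variation of the energy at nu in the direction of a segment measure. *)
Let mutual_segment_ge (x r : R) : r != 0 -> (forall th, I01 th -> K (x + th * r)) ->
  (E%:E <= mutual_energy D nu (segment_prob x r))%E.
Proof.
move=> r0 seg; set sg := segment_prob x r.
have fin (P : probability (plane R) R) : exists b : R, mutual_energy D P sg = b%:E.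
  exists (fine (mutual_energy D P sg)); rewrite fineK// ge0_fin_numE//.
  exact: le_lt_trans (mutual_energy_segment_le _ _ _ r0) (ltry _).
have [b bE] := fin nu; have [c cE] := fin sg.
rewrite bE lee_fin leNgt; apply/negP => bltE.
have var (t : R) : 0 < t -> t < 1 -> 0 <= 2 * (b - E) + t * (E - 2 * b + c).
  move=> t0 t1; have t1' : 0 <= 1 - t by rewrite subr_ge0 ltW.
  have := mutual_min (convex_prob_on (ltW t0) t1' nu0 (seg_on seg)).
  rewrite mutual_energy_convex_prob mutual_nu (mutual_energyC _ _ nu) bE cE => hE.
  have h : E <= (1 - t) * ((1 - t) * E + t * b) + t * ((1 - t) * b + t * c).
    by rewrite -lee_fin EFinD !EFinM !EFinD !EFinM.
  rewrite -(pmulr_rge0 _ t0); apply: le_trans (_ : 0 <= _ - E) _; first by rewrite subr_ge0; exact: h.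
  by rewrite le_eqVlt; apply/orP; left; apply/eqP; ring.
pose del := E - b; pose q := `|E - 2 * b + c|.
have del0 : 0 < del by rewrite subr_gt0.
have q0 : 0 <= q by exact: normr_ge0.
have den0 : 0 < q + del + 1 by rewrite ltr_wpDl// addr_ge0// ltW.
(* Small enough for the second-order term, at most t * q, to be absorbed by del. *)
pose t := del / (q + del + 1).
have t0 : 0 < t by rewrite divr_gt0.
have t1 : t < 1 by rewrite ltr_pdivrMr// mul1r; lra.
have tq : t * q <= del by rewrite mulrAC ler_pdivrMr//; nra.
have := var t t0 t1.
have : t * (E - 2 * b + c) <= t * q by rewrite ler_pM2l// ler_norm.
by rewrite /del in tq del0 *; lra.
Qed.

Let pot_ge x : K x -> (E%:E <= pot D nu (ofR x))%E.
Proof.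
move=> Kx; have [r r0 seg] := segK Kx.
have cv := @mutual_energy_segment_cvg _ D nu K x r closedK nu0 r0.
rewrite -(cvg_lim _ cv)//; apply: lime_ge; first by apply/cvg_ex; eexists; exact: cv.
by apply: nearW => n; apply: mutual_segment_ge; [exact: divS_neq0|exact: subsegment].
Qed.

Let S := K `&` [set x | (pot D nu (ofR x) <= E%:E)%E].

(* Lower semicontinuity of the potential, by Fatou's lemma. *)
Let closedS : closed S.
Proof.
apply: closedI => // x xcl /=.
have /choice[u uP] : forall n : nat, exists y : R,
    (pot D nu (ofR y) <= E%:E)%E /\ `|x - y| < n.+1%:R^-1.
  move=> n; have n0 : 0 < n.+1%:R^-1 :> R by rewrite invr_gt0.
  have [y [yE /=]] := xcl _ (nbhsx_ballx x n.+1%:R^-1 n0).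
  by rewrite -ball_normE /= => xy; exists y.
have ux : u n @[n --> \oo] --> x.
  apply/cvgrPdist_lt => e e0; have := @cvg_harmonic R => /cvgrPdist_lt/(_ _ e0).
  apply: filterS => n; rewrite sub0r normrN ger0_norm ?invr_ge0// => h.
  exact: lt_trans (uP n).2 h.
have pk n : measurable_fun setT (pker D (ofR (u n))) by exact: measurable_pker_r.
have := fatou nu measurableT pk (fun n w _ => pker_ge0 D (ofR (u n)) w).
rewrite (eq_integral (pker D (ofR x))); last first.
  move=> w _; have cw : pker D (ofR (u n)) w @[n --> \oo] --> pker D (ofR x) w.
    have c1 : ofR (u n) - w @[n --> \oo] --> ofR x - w.
      apply: cvgB; last exact: cvg_cst.
      by apply: (@cvg_pair _ _ _ _ (nbhs x) (nbhs (0 : R))); [exact: ux|exact: cvg_cst].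
    exact: (cvg_comp _ _ (cvg_comp _ _ c1 (@continuous_modulus R _)) (@continuous_logker R D _)).
  by have [-> _] := cvg_limn_einf_sup cw.
move/le_trans; apply; rewrite limn_einf_lim; apply: lime_le; first exact: is_cvg_einfs.
apply: nearW => n; apply: le_trans (uP n).1.
by apply: ereal_inf_lbound; exists n => /=.
Qed.

(* On K the potential is at least E and its integral is E. *)
Let S_conull : nu (~` (ofR @` S)) = 0%E.
Proof.
have mS' : measurable (ofR @` S) by exact: measurable_ofR_image.
pose g z := (pot D nu z - E%:E)%E.
have mg : measurable_fun setT g by apply: emeasurable_funB => //; exact: measurable_pot.
have g0 z : (ofR @` K) z -> (0 <= g z)%E.
  by move=> [x Kx <-]; rewrite sube_ge0// pot_ge.
have intg : (\int[nu]_(z in ofR @` K) `|g z| = 0)%E.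
  rewrite (eq_integral g); last by move=> z /set_mem /g0 /gee0_abs.
  rewrite (integral_conull mK' nu0 mg) integralB_cst//.
  - by rewrite -/(mutual_energy D nu nu) mutual_nu subee.
  - exact: probability_setT.
  - exact: measurable_pot.
  - by move=> z; exact: pot_ge0.
have [N [mN N0 sub]] := (ae_eq_integral_abs nu mK' (measurable_funTS mg)).1 intg.
have cover : ~` (ofR @` S) `<=` ~` (ofR @` K) `|` N.
  move=> z zS; have [[x Kx xz]|] := pselect ((ofR @` K) z); last by left.
  right; apply: sub => /= /(_ (ex_intro2 _ _ x Kx xz)) gz0; apply: zS.
  exists x => //; split => //=; rewrite xz -sube_le0.
  by rewrite -/(g z) gz0.
apply/eqP; rewrite -measure_le0.
apply: (@le_trans _ _ (nu (~` (ofR @` K) `|` N))).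
  apply: le_measure => //; rewrite inE; first exact: measurableC.
  by apply: measurableU => //; exact: measurableC.
apply: le_trans (measureU2 _ (measurableC mK') mN) _.
by rewrite [X in (X + _)%E]nu0 [X in (_ + X)%E]N0 adde0.
Qed.

(** Frostman's theorem without exceptional set: the maximum principle, applied on
    the closed set S of full measure where the potential is at most E, extends
    this bound to K. *)
Theorem equilibrium_potential : exists C : R, forall x, K x -> pot D nu (ofR x) = C%:E.
Proof.
exists E => x Kx; apply/eqP; rewrite eq_le pot_ge// andbT.
apply: (@pot_max_principle _ nu S) => //.
- have [M [Mr HM]] := compact_bounded cK; exists M; split => // C MC s [Ks _].
  exact: (HM _ MC).
- by have [_ [s Ss _]] := @prob_on_neq0 _ _ nu S_conull; exists s.
- by move=> s [].
Qed.

End equilibrium.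

(** * The potential of a harmonic measure *)

Section harmonic_measure_potential.
Context {R : realType}.
Local Notation I01 := (`[0%R, 1%R]%classic : set R).
Variables (K : set R) (D : R) (y : R) (omega : probability (plane R) R).
Hypotheses (cK : compact K).
Hypothesis KD : forall x y, K x -> K y -> ln `|x - y| <= D.
Hypothesis segK : forall x, K x -> exists2 r : R, r != 0 &
  forall th, I01 th -> K (x + th * r).
Hypothesis (Ky : ~ K y).
Hypothesis homega : harmonic_measure (ofR y) (ofR @` K) omega.

Let closedK : closed K. Proof. exact: compact_closed. Qed.
Let mK' : measurable (ofR @` K).
Proof. exact: measurable_ofR_image. Qed.

Let closedK' : closed (ofR @` K : set (plane R)).
Proof. exact: closed_ofR_image. Qed.

Let omega0 : prob_on (ofR @` K) omega.
Proof. exact: harmonic_measure_prob_on closedK' homega. Qed.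

Let mutual_segpot (c r : R) : r != 0 -> (forall th, I01 th -> K (c + th * r)) ->
  (mutual_energy D omega (segment_prob c r) = \int[omega]_z (D - segpot c r z)%:E)%E.
Proof.
move=> r0 seg; apply: (eq_integral_conull mK' omega0).
- exact: measurable_pot.
- apply/measurable_EFinP; apply: measurable_funB => //.
  by apply: continuous_measurable_plane; exact: continuous_segpot.
- move=> _ [s Ks <-]; rewrite -/(pot _ _ _) pot_segment_prob integral_logker_dist//.
  by move=> th Ith; rewrite modulus_ofR; apply: KD => //; exact: seg.
Qed.

Let mutual_diff (c1 r1 c2 r2 : R) : r1 != 0 -> r2 != 0 ->
  (forall th, I01 th -> K (c1 + th * r1)) -> (forall th, I01 th -> K (c2 + th * r2)) ->
  mutual_energy D omega (segment_prob c1 r1) =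
  (mutual_energy D omega (segment_prob c2 r2) -
   (segpot c1 r1 (ofR y) - segpot c2 r2 (ofR y))%:E)%E.
Proof.
move=> r10 r20 seg1 seg2.
have onK (c r th : R) : K (c + th * r) -> (ofR @` K) (ofR (c + th * r)).
  by move=> h; exists (c + th * r).
have <- := integral_harmonic_measure_segpot homega r10 r20
  (fun th Ith => onK _ _ _ (seg1 th Ith)) (fun th Ith => onK _ _ _ (seg2 th Ith)).
have msp (c r : R) : r != 0 -> measurable_fun setT (segpot c r).
  by move=> r0; apply: continuous_measurable_plane; exact: continuous_segpot.
have iD : omega.-integrable setT (fun z => (D - segpot c2 r2 z)%:E).
  have mf : measurable_fun setT (fun z => (D - segpot c2 r2 z)%:E).
    by apply/measurable_EFinP; apply: measurable_funB => //; exact: msp.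
  apply/integrableP; split => //.
  apply: (@le_lt_trans _ _ (mutual_energy D omega (segment_prob c2 r2))); last first.
    exact: le_lt_trans (mutual_energy_segment_le _ _ _ r20) (ltry _).
  rewrite mutual_segpot//; rewrite le_eqVlt; apply/orP; left; apply/eqP.
  apply: (eq_integral_conull mK' omega0) => //; first exact: measurableT_comp.
  move=> _ [s Ks <-]; rewrite gee0_abs//.
  rewrite -integral_logker_dist//; last first.
    by move=> th Ith; rewrite modulus_ofR; apply: KD => //; exact: seg2.
  by apply: integral_ge0 => th _; exact: logker_ge0.
have idiff : omega.-integrable setT (fun z => (segpot c1 r1 z - segpot c2 r2 z)%:E).
  have [M HM] := @segpot_diff_bounded R c1 r1 c2 r2 r10 r20.
  have mf : measurable_fun setT (fun z => (segpot c1 r1 z - segpot c2 r2 z)%:E).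
    by apply/measurable_EFinP; apply: measurable_funB; exact: msp.
  apply/integrableP; split => //.
  apply: (@le_lt_trans _ _ (\int[omega]_z M%:E)%E).
    apply: ge0_le_integral => //; first exact: measurableT_comp.
    by move=> z _; rewrite abse_EFin lee_fin; exact: (HM (Some z)).
  by rewrite integral_cst//= probability_setT mule1 ltry.
rewrite !mutual_segpot// -integralB//.
have e (d p q : R) : d - p = (d - q) - (p - q) by ring.
by apply: eq_integral => z _; rewrite -EFinB -e.
Qed.

(* Convergence of the averages at y, read off from the truncated kernel for a
   bound D' that covers all the distances from y. *)
Let segpot_cvg (x r : R) : r != 0 -> x != y ->
  segpot x (r / n.+1%:R) (ofR y) @[n --> \oo] --> ln `|x - y|.
Proof.
move=> r0 xy.
have yx0 : 0 < `|y - x| by rewrite normr_gt0 subr_eq0 eq_sym.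
(* The summand 1 makes D' nonnegative, hence an upper bound also where ln 0 = 0. *)
pose B := `|y - x| + `|r| + 1; pose D' := ln B.
have B1 : 1 <= B by rewrite lerDr addr_ge0.
have B0 : 0 < B by exact: lt_le_trans B1.
have D'0 : 0 <= D' by exact: ln_ge0.
have rn0 n := divS_neq0 n r0.
have le_D' v : v <= B -> ln v <= D'.
  by have [v0 _|v0 vB] := leP v 0; [rewrite ln0|rewrite ler_ln].
have avgE n : avgker D' (y - x) (r / n.+1%:R) = (D' - segpot x (r / n.+1%:R) (ofR y))%:E.
  rewrite -pot_segment_prob_ofR pot_segment_prob integral_logker_dist// => th.
  rewrite /= in_itv/= modulus_ofR => /andP[th0 th1]; apply: le_D'.
  rewrite opprD addrA (le_trans (ler_normB _ _))//.
  have rn : `|r / n.+1%:R| <= `|r|.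
    by rewrite normrM [`|n.+1%:R^-1|]ger0_norm ?invr_ge0// ler_pdivrMr// ler_peMr// ler1n.
  have : `|th * (r / n.+1%:R)| <= `|r|.
    by rewrite normrM (ger0_norm th0) (le_trans _ rn)// ler_piMl.
  by rewrite /B; lra.
have := @avgker_cvg R D' (y - x) r r0.
rewrite logkerE//; last by apply: le_D'; rewrite /B -addrA lerDl addr_ge0.
under eq_fun do rewrite avgE.
move/fine_cvg => /= cv.
have -> : (fun n => segpot x (r / n.+1%:R) (ofR y)) =
    (fun n => D' - (D' - segpot x (r / n.+1%:R) (ofR y))).
  by apply/funext => n; rewrite subKr.
rewrite distrC -(subKr D' (ln `|y - x|)).
by apply: cvgB; [exact: cvg_cst|exact: cv].
Qed.

(** By [mutual_diff], the mutual energy with a segment differs from minus the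
    segment potential at y by a constant independent of the segment; shrink the
    segment to x. *)
Theorem harmonic_measure_potential : exists C : R, forall x, K x ->
  pot D omega (ofR x) = (C - ln `|x - y|)%:E.
Proof.
have [[x0 Kx0]|K0] := pselect (K !=set0); last first.
  by exists 0 => x Kx; case: K0; exists x.
have [r1 r10 seg1] := segK Kx0.
have [m mE] : exists m : R, mutual_energy D omega (segment_prob x0 r1) = m%:E.
  exists (fine (mutual_energy D omega (segment_prob x0 r1))); rewrite fineK// ge0_fin_numE.
    exact: le_lt_trans (mutual_energy_segment_le _ _ _ r10) (ltry _).
  by apply: integral_ge0 => z _; exact: pot_ge0.
exists (m + segpot x0 r1 (ofR y)) => x Kx.
have [r r0 seg] := segK Kx.
have xy : x != y by apply/eqP => xy; apply: Ky; rewrite -xy.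
have rn0 n := divS_neq0 n r0.
have segn n := @subsegment _ K x r n seg.
have cv1 := @mutual_energy_segment_cvg _ D omega K x r closedK omega0 r0.
have cv2 : mutual_energy D omega (segment_prob x (r / n.+1%:R)) @[n --> \oo] -->
    (m + segpot x0 r1 (ofR y) - ln `|x - y|)%:E.
  have e (p q v : R) : p - (q - v) = p + v - q by ring.
  have -> : (fun n => mutual_energy D omega (segment_prob x (r / n.+1%:R))) =
      (fun n => (m + segpot x0 r1 (ofR y) - segpot x (r / n.+1%:R) (ofR y))%:E).
    apply/funext => n; rewrite (mutual_diff (rn0 n) r10 (segn n) seg1) mE -EFinB.
    by rewrite e.
  have cv : m + segpot x0 r1 (ofR y) - segpot x (r / n.+1%:R) (ofR y) @[n --> \oo] -->
      m + segpot x0 r1 (ofR y) - ln `|x - y|.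
    by apply: cvgB; [exact: cvg_cst|exact: segpot_cvg].
  exact: (cvg_EFin_comp cv).
by rewrite -(cvg_lim _ cv1)//; apply/cvg_lim.
Qed.

End harmonic_measure_potential.

(** * From the compact set to the whole plane *)

Section log_potential.
Context {R : realType}.
Variables (K : set R) (mu : {measure set (plane R) -> \bar R}).
Hypotheses (cK : compact K) (mu1 : mu setT = 1%E) (mu0 : mu (~` (ofR @` K)) = 0%E).
Implicit Types (D : R) (w : plane R).

Let closedK : closed K. Proof. exact: compact_closed. Qed.
Let mK' : measurable (ofR @` K).
Proof. exact: measurable_ofR_image. Qed.

Let m_log w : measurable_fun setT (fun z : plane R => log_abs (toC (z - w))).
Proof. exact: measurableT_comp measurable_log_abs (measurable_pair2 w). Qed.

Let m_pker D w : measurable_fun setT (pker D w).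
Proof. exact: measurable_pker_r. Qed.

Lemma integral_log_abs D w : (forall s, K s -> ln (modulus (ofR s - w)) <= D) ->
  (\int[mu]_z log_abs (toC (z - w)%R) = D%:E - pot D mu w)%E.
Proof.
move=> wD; rewrite /pot -integral_cstB//; last by move=> z; exact: pker_ge0.
apply: (eq_integral_conull mK' mu0) => //.
  by apply: emeasurable_funB.
by move=> _ [s Ks <-]; rewrite pkerC; apply: log_abs_pker; exact: wD.
Qed.

Lemma log_dist_bound w : exists2 D, forall s, K s -> ln (modulus (ofR s - w)) <= D &
  forall s s', K s -> K s' -> ln `|s - s'| <= D.
Proof.
have [M [_ /(_ (`|M| + 1)) HM]] := compact_bounded cK.
have {}HM s : K s -> `|s| <= `|M| + 1.
  by apply: HM; rewrite (le_lt_trans (ler_norm M))// ltrDl.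
pose B := 1 + (`|M| + 1) + (`|M| + 1) + `|w.1| + `|w.2|.
have B1 : 1 <= B by rewrite /B -!addrA lerDl !addr_ge0.
have D0 : 0 <= ln B by exact: ln_ge0.
have B0 : 0 < B by exact: lt_le_trans B1.
have le_D v : v <= B -> ln v <= ln B.
  by have [v0 _|v0 vB] := leP v 0; [rewrite ln0|rewrite ler_ln].
have w1 := normr_ge0 w.1; have w2 := normr_ge0 w.2; have M0 := normr_ge0 M.
exists (ln B) => [s Ks|s s' Ks Ks']; apply: le_D.
  have hm : modulus (ofR s - w) <= `|s - w.1| + `|w.2|.
    rewrite -(@ler_pXn2r _ 2)// ?nnegrE ?modulus_ge0 ?addr_ge0// sqr_sqrtr ?addr_ge0 ?sqr_ge0//=.
    rewrite sub0r sqrrN [leRHS]sqrrD !real_normK ?num_real// -addrA lerD2l lerDr.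
    by rewrite mulrn_wge0// mulr_ge0.
  apply: (le_trans hm); have := HM _ Ks; have := ler_normB s w.1; rewrite /B; lra.
by have := HM _ Ks; have := HM _ Ks'; have := ler_normB s s'; rewrite /B; lra.
Qed.

(** For D large enough, U(w) >= 0 says that the truncated potential at w is at
    most D, so the maximum principle applies; it reaches complex w because the
    distance from w to a real point is at least that from the real part of w. *)
Lemma log_potential_ge0 : K !=set0 ->
  (forall s, K s -> (0 <= \int[mu]_z log_abs (toC (z - ofR s)%R))%E) ->
  forall w, (0 <= \int[mu]_z log_abs (toC (z - w)%R))%E.
Proof.
move=> K0 Kpos w; have [D wD KD] := log_dist_bound w.
rewrite (integral_log_abs wD) sube_ge0 ?orbT//.
have mS := mK'.
have potK s : K s -> (pot D mu (ofR s) <= D%:E)%E.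
  move=> Ks; have sD s' : K s' -> ln (modulus (ofR s' - ofR s)) <= D.
    by move=> Ks'; rewrite modulus_ofR; exact: KD.
  by have := Kpos _ Ks; rewrite (integral_log_abs sD) sube_ge0 ?orbT.
have := @pot_max_principle _ mu K D D%:E closedK _ K0 mu0 potK w.1.
move=> /(_ (compact_bounded cK)); apply: le_trans.
apply: (le_integral_conull mK' mu0) => //; first by move=> z; exact: pker_ge0.
move=> _ [s Ks <-]; rewrite /pker modulus_ofR; apply: logker_le.
exact: normr_le_modulus (w - ofR s).
Qed.

Lemma integrable_log_abs w : (0 <= \int[mu]_z log_abs (toC (z - w)%R))%E ->
  mu.-integrable (ofR @` K) (fun z : plane R => log_abs (toC (z - w))).
Proof.
have [D wD _] := log_dist_bound w.
rewrite (integral_log_abs wD) sube_ge0 ?orbT// => potD.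
have iD : mu.-integrable (ofR @` K) (cst D%:E).
  apply/integrableP; split => //; rewrite integral_cst//= lte_mul_pinfty// ?lee_fin//.
  by apply: (@le_lt_trans _ _ (mu setT)); [apply: le_measure; rewrite ?inE|rewrite mu1 ltry].
have ik : mu.-integrable (ofR @` K) (pker D w).
  apply/integrableP; split; first exact: measurable_funTS.
  rewrite (eq_integral (pker D w)); last by move=> z _; rewrite gee0_abs// pker_ge0.
  by rewrite (integral_conull mK' mu0)//; exact: le_lt_trans potD (ltry _).
have := @integrableB _ _ _ mu _ mK' _ _ iD ik; apply: eq_integrable => //.
by move=> z /set_mem [s Ks <-]; rewrite /= pkerC (log_abs_pker (wD _ Ks)).
Qed.

End log_potential.

(** * Integer polynomials *)

Section polynomials.
Context {R : realType}.
Implicit Types (z w : plane R) (x y : R[i]).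

Lemma ofCK : cancel (@ofC R) (@toC R). Proof. by case. Qed.

Lemma toCB z w : toC (z - w) = toC z - toC w.
Proof. by case: z w => [a b] [c d]. Qed.

Lemma normc_ge0 x : 0 <= Normc.normc x.
Proof. by case: x => a b; exact: sqrtr_ge0. Qed.

(** Both sides are -oo when a factor vanishes, since log_abs never takes the value
    +oo. *)
Lemma log_absM x y : log_abs (x * y) = (log_abs x + log_abs y)%E.
Proof.
rewrite /log_abs Normc.normcM.
move: (Normc.normc x) (Normc.normc y) (normc_ge0 x) (normc_ge0 y) => p q.
rewrite le_eqVlt => /predU1P[<- q0|p0].
  by rewrite mul0r /lne lexx addNye//; case: ifP.
rewrite le_eqVlt => /predU1P[<-|q0].
  by rewrite mulr0 /lne lexx addeNy//; case: ifP.
rewrite /lne !leNgt p0 q0 mulr_gt0//= lnM ?posrE//.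
Qed.

(** A nonzero integer has modulus at least 1; applied to the leading coefficient
    of Q. *)
Lemma log_abs_int_ge0 (n : int) : n != 0 ->
  exists2 c : R, 0 <= c & log_abs (n%:~R : R[i]) = c%:E.
Proof.
move=> n0; have nE : Normc.normc (n%:~R : R[i]) = `|n|%:~R :> R.
  rewrite -(rmorph_int (real_complex R)) /= /Normc.normc /= expr0n addr0 sqrtr_sqr.
  by rewrite intr_norm.
have n1 : 1 <= `|n|%:~R :> R.
  by rewrite -[1]/(1%:~R) ler_int -gtz0_ge1 normr_gt0.
exists (ln `|n|%:~R); first exact: ln_ge0.
by rewrite /log_abs nE lne_EFin// (lt_le_trans _ n1).
Qed.

Lemma log_abs_pevalE (Q : {poly int}) : Q != 0 -> exists2 c : R, 0 <= c &
  exists rs : seq (plane R), forall z,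
    log_abs (peval Q z) = (c%:E + \sum_(w <- rs) log_abs (toC (z - w)%R))%E.
Proof.
move=> Q0; pose P : {poly R[i]} := map_poly intr Q.
have [c c0 cE] : exists2 c : R, 0 <= c & log_abs (lead_coef P) = c%:E.
  have -> : lead_coef P = (lead_coef Q)%:~R.
    by rewrite lead_coef_map_inj//; exact: intr_inj.
  by apply: log_abs_int_ge0; rewrite lead_coef_eq0.
exists c => //; have [rs Prs] := closed_field_poly_normal P.
exists (map (@ofC R) rs) => z.
rewrite /peval -/P Prs hornerZ log_absM cE horner_prod; congr (_ + _)%E.
elim: rs {Prs} => [|w rs IH] /=.
  by rewrite !big_nil /log_abs Normc.normc1 lne1.
by rewrite !big_cons log_absM IH hornerXsubC toCB ofCK.
Qed.

Lemma peval_XsubC (n : int) z : peval ('X - n%:P) z = toC (z - ofR n%:~R).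
Proof.
rewrite /peval rmorphB /= map_polyX map_polyC /= hornerXsubC toCB; congr (_ - _).
by rewrite -(rmorph_int (real_complex R)).
Qed.

End polynomials.

Section integer_polynomials.
Context {R : realType}.
Variables (K : set R) (mu : {measure set (plane R) -> \bar R}).
Hypotheses (cK : compact K) (mu1 : mu setT = 1%E) (mu0 : mu (~` (ofR @` K)) = 0%E).

Lemma integral_log_abs_peval_ge0 :
  (forall w, (0 <= \int[mu]_z log_abs (toC (z - w)%R))%E) ->
  forall Q : {poly int}, Q != 0 -> (0 <= \int[mu]_z log_abs (peval Q z))%E.
Proof.
move=> hw Q Q0; have [c c0 [rs QE]] := @log_abs_pevalE R Q Q0.
have mK' : measurable (ofR @` K).
  by apply: measurable_ofR_image; exact: compact_closed.
have m_log (w : plane R) : measurable_fun setT (fun z : plane R => log_abs (toC (z - w))).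
  exact: measurableT_comp measurable_log_abs (measurable_pair2 w).
have iw w : mu.-integrable (ofR @` K) (fun z : plane R => log_abs (toC (z - w))).
  by apply: integrable_log_abs.
pose S rs' (z : plane R) := (\sum_(w <- rs') log_abs (toC (z - w)%R))%E.
have S_cons w rs' : S (w :: rs') = (fun z => log_abs (toC (z - w)%R) + S rs' z)%E.
  by apply/funext => z; rewrite /S big_cons.
have S_nil : S [::] = cst 0%E by apply/funext => z; rewrite /S big_nil.
rewrite (eq_integral (fun z => (c%:E + S rs z)%E)); last by move=> z _; exact: QE.
have [mS iS S0] : [/\ measurable_fun setT (S rs),
    mu.-integrable (ofR @` K) (S rs) & (0 <= \int[mu]_(z in ofR @` K) S rs z)%E].
  elim: rs {QE} => [|w rs [mS iS S0]].
    rewrite S_nil; split; [exact: measurable_cst|exact: integrable0|by rewrite integral0].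
  rewrite S_cons; split; first exact: emeasurable_funD.
    exact: (@integrableD _ _ _ mu _ mK' _ _ (iw w) iS).
  rewrite (@integralD _ _ _ mu _ mK' _ _ (iw w) iS); apply: adde_ge0 => //.
  by rewrite (integral_conull mK' mu0).
have ic : mu.-integrable (ofR @` K) (cst c%:E).
  apply/integrableP; split => //; rewrite integral_cst//= lte_mul_pinfty// ?lee_fin//.
  by apply: (@le_lt_trans _ _ (mu setT)); [apply: le_measure; rewrite ?inE|rewrite mu1 ltry].
rewrite -(integral_conull mK' mu0); last exact: emeasurable_funD.
rewrite (@integralD _ _ _ mu _ mK' _ _ ic iS); apply: adde_ge0 => //.
by rewrite integral_cst// mule_ge0.
Qed.

End integer_polynomials.

(** * Unions of integer intervals *)

Section integer_intervals_facts.
Context {R : realType}.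
Local Notation I01 := (`[0%R, 1%R]%classic : set R).

Lemma ln_dist_concave (a b y th : R) : a < b -> 0 <= th <= 1 -> (y < a) || (b < y) ->
  (1 - th) * ln `|a - y| + th * ln `|b - y| <= ln `|(1 - th) * a + th * b - y|.
Proof.
move=> ab /andP[th0 th1] yab; set x := _ + th * b.
have th1' : 0 <= 1 - th by rewrite subr_ge0.
have th1le : 1 - th <= 1 by rewrite gerBl.
have ax : a <= x by rewrite /x; nra.
have xb : x <= b by rewrite /x; nra.
have [pa pb dE] : [/\ 0 < `|a - y|, 0 < `|b - y| &
    `|x - y| = (1 - th) * `|a - y| + th * `|b - y|].
  case/orP: yab => h.
    have [h1 h2 h3] : [/\ 0 < a - y, 0 < b - y & 0 < x - y] by split; lra.
    by rewrite !gtr0_norm//; split => //; rewrite /x; ring.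
  have [h1 h2 h3] : [/\ a - y < 0, b - y < 0 & x - y < 0] by split; lra.
  by rewrite !ltr0_norm// !oppr_gt0; split => //; rewrite /x; ring.
have := @concave_ln R (Itv01 th1' th1le) _ _ pa pb.
by rewrite !convRE /= /unstable.onem subKr dE.
Qed.

Variables (m : nat) (a b : 'I_m -> int).
Hypothesis hab : forall j, (a j < b j)%R.
Let K : set R := integer_intervals a b.

Lemma compact_integer_intervals : compact K.
Proof.
have -> : K = \big[setU/set0]_(j <- index_enum 'I_m) `[(a j)%:~R, (b j)%:~R]%classic.
  rewrite -bigcup_seq /K /integer_intervals; congr bigcup.
  by apply/seteqP; split=> j //= _; exact: mem_index_enum.
by apply: bigsetU_compact => j _; exact: segment_compact.
Qed.

(** An interval of positive length contains a segment starting at any of its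
    points, towards one of its ends. *)
Lemma segment_integer_intervals x : K x -> exists2 r : R, r != 0 &
  forall th, I01 th -> K (x + th * r).
Proof.
move=> [j _ /=]; rewrite in_itv/= => /andP[ax xb].
have ab : (a j)%:~R < (b j)%:~R :> R by rewrite ltr_int.
have [xltb|bx] := ltP x (b j)%:~R.
  exists ((b j)%:~R - x); first by rewrite subr_eq0 gt_eqF.
  move=> th /=; rewrite in_itv/= => /andP[th0 th1]; exists j => //=.
  by rewrite in_itv/=; apply/andP; split; nra.
exists ((a j)%:~R - x); first by rewrite subr_eq0 lt_eqF// (lt_le_trans ab).
move=> th /=; rewrite in_itv/= => /andP[th0 th1]; exists j => //=.
by rewrite in_itv/=; apply/andP; split; nra.
Qed.

End integer_intervals_facts.

Theorem corollary5p3 (R : realType) (m n : nat) (a b : 'I_m -> int)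
  (y : 'I_n -> R) (t : 'I_n.+1 -> {nonneg R})
  (nu : probability (plane R) R) (omega : 'I_n -> probability (plane R) R)
  (hab : forall j, (a j < b j)%R)
  (hdisj : forall j k, j != k ->
    `[(a j)%:~R, (b j)%:~R]%classic `&` `[(a k)%:~R, (b k)%:~R]%classic
      = set0 :> set R)
  (hy : forall i, ~ integer_intervals a b (y i))
  (ht1 : forall i, (t i)%:num <= 1)
  (htsum : \sum_i (t i)%:num = 1)
  (hnu : equilibrium_measure (ofR @` integer_intervals a b) nu)
  (homega : forall i,
    harmonic_measure (ofR (y i)) (ofR @` integer_intervals a b) (omega i)) :
  (forall Q : {poly int}, Q != 0 ->
     (0 <= \int[mixture t nu omega]_z log_abs (peval Q z))%E)
  <->
  (forall j : 'I_m,
     (0 <= \int[mixture t nu omega]_z log_abs (toC (z - ofR (a j)%:~R)%R))%E /\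
     (0 <= \int[mixture t nu omega]_z log_abs (toC (z - ofR (b j)%:~R)%R))%E).
Proof.
split=> [hQ j|hab0].
  have h k : (0 <= \int[mixture t nu omega]_z log_abs (toC (z - ofR k%:~R)%R))%E.
    have Xk : 'X - k%:P != 0 :> {poly int} by rewrite polyXsubC_eq0.
    have := hQ _ Xk.
    by under eq_integral do rewrite peval_XsubC.
  by split; exact: h.
pose K : set R := integer_intervals a b.
have cK : compact K by exact: compact_integer_intervals.
have segK := @segment_integer_intervals R m a b hab.
have [D _ KD] := @log_dist_bound R K cK 0.
have mu1 : mixture t nu omega setT = 1%E by exact: mixture_setT.
have closedK : closed K by exact: compact_closed.
have nuK : prob_on (ofR @` K) nu by case: hnu.
have [Cnu potnu] := equilibrium_potential cK KD segK hnu.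
have /choice[Com potom] : forall i, exists C, forall x, K x ->
    pot D (omega i) (ofR x) = (C - ln `|x - y i|)%:E.
  by move=> i; exact: (harmonic_measure_potential cK KD segK (hy i) (homega i)).
pose mass := (t ord0)%:num * Cnu +
  \sum_(i < n) (t (lift ord0 i))%:num * Com i.
pose U x := D - mass + \sum_(i < n) (t (lift ord0 i))%:num * ln `|x - y i|.
have mu0 : mixture t nu omega (~` (ofR @` K)) = 0%E.
  apply: mixture_null => // i.
  have closedK' := closed_ofR_image closedK.
  exact: (harmonic_measure_prob_on closedK' (homega i)).
have potE x : K x -> (\int[mixture t nu omega]_z log_abs (toC (z - ofR x)%R) = (U x)%:E)%E.
  move=> Kx; have xD s : K s -> ln (modulus (ofR s - ofR x)) <= D.
    by move=> Ks; rewrite modulus_ofR; exact: KD.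
  rewrite (integral_log_abs cK mu1 mu0 xD) /pot ge0_integral_mixture; last 2 first.
  - exact: measurable_pker_r.
  - by move=> z; exact: pker_ge0.
  rewrite -/(pot _ _ _) potnu//.
  under eq_bigr => i _ do rewrite -/(pot _ _ _) potom// -EFinM.
  rewrite sumEFin -EFinM -EFinD; congr EFin.
  under eq_bigr do rewrite mulrBr.
  by rewrite big_split /= sumrN /U /mass; ring.
have Uconcave j (th : R) : 0 <= th <= 1 ->
    (1 - th) * U (a j)%:~R + th * U (b j)%:~R <= U ((1 - th) * (a j)%:~R + th * (b j)%:~R).
  move=> th01.
  have -> : (1 - th) * U (a j)%:~R + th * U (b j)%:~R = D - mass +
      \sum_(i < n) (t (lift ord0 i))%:num *
        ((1 - th) * ln `|(a j)%:~R - y i| + th * ln `|(b j)%:~R - y i|).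
    under eq_bigr do rewrite mulrDr mulrCA (mulrCA _ th).
    by rewrite big_split /= -!mulr_sumr /U; ring.
  rewrite /U lerD2l; apply: ler_sum => i _; apply: ler_wpM2l => //.
  apply: ln_dist_concave => //; first by rewrite ltr_int.
  have [|h1] := ltP (y i) (a j)%:~R => //=.
  rewrite ltNge; apply/negP => h2; apply: (hy i); exists j => //=.
  by rewrite in_itv/= h1.
have Kpos x : K x -> (0 <= \int[mixture t nu omega]_z log_abs (toC (z - ofR x)%R))%E.
  move=> Kx; rewrite potE// lee_fin; case: Kx => j _ /=; rewrite in_itv/= => /andP[ax xb].
  have ab : (a j)%:~R < (b j)%:~R :> R by rewrite ltr_int.
  have Ka : K (a j)%:~R by exists j => //=; rewrite in_itv/= lexx ltW.
  have Kb : K (b j)%:~R by exists j => //=; rewrite in_itv/= lexx ltW.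
  have [Ua Ub] := hab0 j; rewrite potE// lee_fin in Ua; rewrite potE// lee_fin in Ub.
  have ba : 0 < (b j)%:~R - (a j)%:~R :> R by rewrite subr_gt0.
  pose th := (x - (a j)%:~R) / ((b j)%:~R - (a j)%:~R).
  have th0 : 0 <= th by rewrite divr_ge0// ?subr_ge0// ltW.
  have th1 : th <= 1 by rewrite ler_pdivrMr// mul1r lerD2r.
  have xE : x = (1 - th) * (a j)%:~R + th * (b j)%:~R.
    by rewrite /th; field; rewrite gt_eqF.
  rewrite xE; apply: le_trans (Uconcave _ _ _); last by rewrite th0 th1.
  by rewrite addr_ge0// mulr_ge0// subr_ge0.
have K0 : K !=set0 by have [_ [x Kx _]] := prob_on_neq0 nuK; exists x.
exact: (integral_log_abs_peval_ge0 cK mu1 mu0 (log_potential_ge0 cK mu1 mu0 K0 Kpos)).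
Qed.
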